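(* Let $N\ge1$, let $\Omega\subset\mathbb{R}^N$ be a bounded connected domain with a $C^{1,1}$-boundary, and let $p$ satisfy: $p\in[2,+\infty)$ if $N<4$; $p\in(2,+\infty)$ if $N=4$; $p\in[N/2,+\infty)$ if $N>4$. For $q_0\in L^p(\Omega)$ and $\lambda>\lambda_1(q_0)$ let $\hat q(\lambda,q_0)\in L^p(\Omega)$ and $\hat u(\lambda,q_0)\in W^{1,2}_0(\Omega)$ be as defined in the context. Then: (i) For any $\lambda\in\mathbb{R}$, the map $q_0\mapsto\hat u(\lambda,q_0)$ from $\{q_0\in L^p(\Omega):\lambda_1(q_0)<\lambda\}$ (with the $L^p$ topology) to $W^{1,2}_0(\Omega)$ is continuous, and thus $q_0\mapsto\hat q(\lambda,q_0)$ is continuous from this subset of $L^p(\Omega)$ to $L^p(\Omega)$. (ii) For any $q_0\in L^p(\Omega)$, the map $\lambda\mapsto\hat u(\lambda,q_0)$ from $(\lambda_1(q_0),+\infty)$ to $W^{1,2}_0(\Omega)$ is continuous, and thus $\lambda\mapsto\hat q(\lambda,q_0)$ is continuous from $(\lambda_1(q_0),+\infty)$ to $L^p(\Omega)$. Moreover, $\hat q(\lambda,q_0)\to q_0$ in $L^p(\Omega)$ as $\lambda\downarrow\lambda_1(q_0)$.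
   Context: All functions are real-valued. For $q\in L^p(\Omega)$, $\lambda_1(q)$ denotes the principal (smallest) eigenvalue of $\mathcal{L}_q\phi:=-\Delta\phi+q\phi$ in $\Omega$ with Dirichlet boundary condition (domain $W^{2,2}(\Omega)\cap W^{1,2}_0(\Omega)$), i.e. $$\lambda_1(q)=\inf_{\phi\in W^{1,2}_0(\Omega)\setminus\{0\}}\frac{\int_\Omega|\nabla\phi|^2\,dx+\int_\Omega q\phi^2\,dx}{\int_\Omega\phi^2\,dx}.$$ For $q_0\in L^p(\Omega)$ and $\lambda>\lambda_1(q_0)$, $\hat q(\lambda,q_0)$ denotes the unique potential $\hat q\in L^p(\Omega)$ such that $\lambda=\lambda_1(\hat q)$ and $$\|q_0-\hat q\|_{L^p}=\inf\{\|q_0-q\|_{L^p}:\ \lambda=\lambda_1(q),\ q\in L^p(\Omega)\},$$ and $\hat u(\lambda,q_0)\in W^{1,2}_0(\Omega)$ denotes the corresponding weak positive solution of $$-\Delta u+q_0u=\lambda u-u^{\frac{p+1}{p-1}}\ \text{ in }\Omega,\qquad u>0\ \text{ in }\Omega,\qquad u|_{\partial\Omega}=0,$$ related to $\hat q$ by $\hat q(\lambda,q_0)=q_0+\hat u(\lambda,q_0)^{2/(p-1)}$ a.e. in $\Omega$. (Existence and uniqueness of $\hat q$ and existence of $\hat u$ are established beforehand in the paper.) The norm on $W^{1,2}_0(\Omega)$ is $\|u\|_1=(\int_\Omega|\nabla u|^2dx)^{1/2}$. *)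

(* Defs.v *)
From HB Require Import structures.
From mathcomp Require Import all_boot all_order all_algebra.
From mathcomp Require Import all_classical all_reals all_analysis.

Set Implicit Arguments.
Unset Strict Implicit.
Unset Printing Implicit Defensive.

Import Order.TTheory GRing.Theory Num.Theory.
Import numFieldNormedType.Exports.

Local Open Scope classical_set_scope.
Local Open Scope ring_scope.

Definition measure_rV_display : measure_display -> measure_display.
Proof. exact. Qed.

Section rV_measurable.
Context (R : realType) (n : nat).

(** The σ-algebra generated by the coordinate functions, i.e. the Borel
    σ-algebra of R^n. *)
Let coords : 'I_n -> 'rV[R]_n -> measurableTypeR R := fun i x => x 0 i.

Let rV_set0 : g_sigma_preimage coords set0.
Proof. exact: sigma_algebra0. Qed.

Let rV_setC A : g_sigma_preimage coords A -> g_sigma_preimage coords (~` A).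
Proof. exact: sigma_algebraC. Qed.

Let rV_bigcup (F : (set 'rV[R]_n)^nat) :
  (forall i, g_sigma_preimage coords (F i)) ->
  g_sigma_preimage coords (\bigcup_i F i).
Proof. exact: sigma_algebra_bigcup. Qed.

HB.instance Definition _ := @isMeasurable.Build
  (measure_rV_display default_measure_display)
  'rV[R]_n (g_sigma_preimage coords) rV_set0 rV_setC rV_bigcup.

End rV_measurable.

Lemma measurable_coord (R : realType) n (i : 'I_n) :
  measurable_fun [set: 'rV[R]_n] (fun x => x 0 i : measurableTypeR R).
Proof.
move=> _ Y mY; rewrite setTI; apply: sub_sigma_algebra => /=.
rewrite -bigcup_seq/=; exists i => /=; first by rewrite mem_index_enum.
by exists Y => //; rewrite setTI.
Qed.

Lemma measurable_fun_rVP d (T : measurableType d) (R : realType) n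
    (f : T -> 'rV[R]_n) :
  (forall i, measurable_fun [set: T] (fun t => f t 0 i : measurableTypeR R)) ->
  measurable_fun [set: T] f.
Proof.
move=> mf _ A mA; rewrite setTI; move: A mA.
pose G : set (set 'rV[R]_n) := [set A | measurable (f @^-1` A)].
suff : @measurable _ 'rV[R]_n `<=` G by [].
apply: smallest_sub.
  split => [|A GA|F GF]; rewrite /G /=.
  - by rewrite preimage_set0.
  - by rewrite setTD preimage_setC; exact: measurableC.
  - by rewrite preimage_bigcup; apply: bigcup_measurable => k _; exact: GF.
move=> A; rewrite -bigcup_seq/= => -[i _ [B mB <-]].
by rewrite /G/= setTI; have := mf i measurableT _ mB; rewrite setTI.
Qed.

Section lebesgue_rV.
Context {R : realType}.

Section step.
Variables (n : nat) (mu : {sigma_finite_measure set 'rV[R]_n -> \bar R}).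

Definition rV_cons (x : measurableTypeR R * 'rV[R]_n) : 'rV[R]_n.+1 :=
  row_mx (const_mx (x.1 : R) : 'rV[R]_1) x.2.

Let rV_uncons (v : 'rV[R]_n.+1) : measurableTypeR R * 'rV[R]_n :=
  ((v : 'rV[R]_(1 + n)) 0 (lshift n ord0), rsubmx (v : 'rV[R]_(1 + n))).

Let rV_consK : cancel rV_cons rV_uncons.
Proof.
move=> [x v]; rewrite /rV_uncons /rV_cons /=; congr pair; last exact: row_mxKr.
by rewrite row_mxEl mxE.
Qed.

Let rV_unconsK : cancel rV_uncons rV_cons.
Proof.
move=> v; rewrite /rV_uncons /rV_cons /=.
have -> : const_mx ((v : 'rV[R]_(1 + n)) 0 (lshift n ord0)) =
    lsubmx (v : 'rV[R]_(1 + n)).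
  by apply/rowP => i; rewrite !mxE (ord1 i).
exact: (@hsubmxK _ 1 1 n v).
Qed.

Lemma measurable_rV_cons : measurable_fun setT rV_cons.
Proof.
apply: measurable_fun_rVP => i.
case: (split_ordP (i : 'I_(1 + n))) => j ->.
  apply: (eq_measurable_fun fst) => [x _|]; last exact: measurable_fst.
  have := row_mxEl (const_mx (x.1 : R) : 'rV_1) x.2 0 j.
  by rewrite [const_mx _ 0 j]mxE => rowE; exact: (esym rowE).
apply: (eq_measurable_fun ((fun v : 'rV[R]_n => v 0 j) \o snd)) => [x _|].
  exact: esym (row_mxEr (const_mx (x.1 : R) : 'rV_1) x.2 0 j).
exact: measurableT_comp (measurable_coord j) measurable_snd.
Qed.

Let measurable_rV_uncons : measurable_fun setT rV_uncons.
Proof.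
apply/measurable_fun_pairP; split.
  exact: measurable_coord.
apply: measurable_fun_rVP => j.
apply: (eq_measurable_fun (fun v : 'rV[R]_n.+1 => v 0 (rshift 1 j : 'I_n.+1))).
  by move=> v _; rewrite /= mxE.
exact: measurable_coord.
Qed.

Definition lebesgue_rV_step : set 'rV[R]_n.+1 -> \bar R :=
  pushforward (lebesgue_measure \x mu)%E rV_cons.

Let step0 : lebesgue_rV_step set0 = 0%E.
Proof. by rewrite /lebesgue_rV_step /pushforward preimage_set0 measure0. Qed.

Let step_ge0 A : (0 <= lebesgue_rV_step A)%E.
Proof. by rewrite /lebesgue_rV_step /pushforward; exact: measure_ge0. Qed.

Let step_sigma_additive : semi_sigma_additive lebesgue_rV_step.
Proof.
move=> F mF tF mUF; rewrite /lebesgue_rV_step /pushforward preimage_bigcup.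
apply: measure_semi_sigma_additive.
- by move=> k; rewrite -[X in measurable X]setTI; exact: measurable_rV_cons.
- apply/trivIsetP => /= i j _ _ ij; rewrite -preimage_setI.
  by move/trivIsetP : tF => /(_ _ _ _ _ ij) ->//; rewrite preimage_set0.
- rewrite -preimage_bigcup -[X in measurable X]setTI.
  exact: measurable_rV_cons.
Qed.

HB.instance Definition _ := isMeasure.Build _ _ _
  lebesgue_rV_step step0 step_ge0 step_sigma_additive.

Let step_sigma_finite : sigma_finite setT lebesgue_rV_step.
Proof.
have /sigma_finiteP[F [TF ndF Foo]] := sigma_finiteT (@lebesgue_measure R).
have /sigma_finiteP[G [TG ndG Goo]] := sigma_finiteT mu.
exists (fun k => rV_uncons @^-1` (F k `*` G k)).
  rewrite -preimage_bigcup (_ : \bigcup_k _ = setT) ?preimage_setT//.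
  apply/seteqP; split => // -[x y] _.
  have [n1 _ Fx] : (\bigcup_i F i) x by rewrite -TF.
  have [n2 _ Gy] : (\bigcup_i G i) y by rewrite -TG.
  exists (maxn n1 n2) => //; split => /=.
  - by move: x Fx; exact/subsetPset/ndF/leq_maxl.
  - by move: y Gy; exact/subsetPset/ndG/leq_maxr.
move=> k; have [mFk Fk] := Foo k; have [mGk Gk] := Goo k; split.
  rewrite -[X in measurable X]setTI; apply: measurable_rV_uncons => //.
  exact: measurableX.
rewrite /lebesgue_rV_step /pushforward -comp_preimage.
have -> : rV_uncons \o rV_cons = id by apply/funext => x; exact: rV_consK.
by rewrite preimage_id product_measure1E// lte_mul_pinfty// ge0_fin_numE.
Qed.

HB.instance Definition _ := @Measure_isSigmaFinite.Build _ _ _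
  lebesgue_rV_step step_sigma_finite.

End step.

(** N-dimensional Lebesgue measure, as an iterated product measure (the Dirac
    mass on the one-point space R^0). *)
Fixpoint lebesgue_rV n : {sigma_finite_measure set 'rV[R]_n -> \bar R} :=
  match n with
  | 0 => \d_(0 : 'rV[R]_0)
  | m.+1 => lebesgue_rV_step (lebesgue_rV m)
  end.

End lebesgue_rV.

Definition partial {R : realType} {N : nat} (i : 'I_N) (f : 'rV[R]_N -> R)
    : 'rV[R]_N -> R :=
  fun x => 'D_(delta_mx 0 i) f x.

Definition C11 {R : realType} {n : nat} (g : 'rV[R]_n -> R) : Prop :=
  (forall x, differentiable g x) /\
  exists L : R, forall i x y, `|partial i g x - partial i g y| <= L * `|x - y|.

Section domains.
Context {R : realType} {N : nat}.
Implicit Types Omega : set 'rV[R]_N.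

(** Near each boundary point, after a rigid motion of the coordinates, [Omega]
    is the region lying above the graph of a C^{1,1} function of the [N - 1]
    coordinates other than the [i]-th one. *)
Definition C11_boundary Omega : Prop :=
  forall x0, (closure Omega `\` interior Omega) x0 ->
  exists (A : 'M[R]_N) (i : 'I_N) (g : 'rV[R]_N.-1 -> R) (r : R),
    [/\ A *m A^T = 1%:M, C11 g, 0 < r &
      forall x, ball x0 r x ->
        let y := (x - x0) *m A in Omega x <-> g (col' i y) < y 0 i].

Definition bounded_C11_domain Omega : Prop :=
  [/\ Omega !=set0, open Omega, connected Omega, bounded_set Omega &
    C11_boundary Omega].

End domains.

(** Elements of L^p(Omega) and W^{1,2}_0(Omega) are represented by functions
    defined on the whole of R^N, whose values outside [Omega] play no role. *)

Section spaces.
Context {R : realType} {N : nat}.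
Variable Omega : set 'rV[R]_N.
Local Notation mu := (@lebesgue_rV R N).
Implicit Types f g u v w phi q : 'rV[R]_N -> R.

Definition in_Lp (p : R) f : Prop := f \_ Omega \in Lfun mu p%:E.

Definition Lp_dist (p : R) f g : R :=
  fine 'N[mu]_p%:E[EFin \o ((f \- g) \_ Omega)].

Definition test_function phi : Prop :=
  (forall (s : seq 'I_N) x, differentiable (foldr partial phi s) x) /\
  exists K, [/\ compact K, K `<=` Omega & forall x, ~ K x -> phi x = 0].

(** Requiring [g] to be in L^2 rather than locally integrable is enough for
    W^{1,2}. *)
Definition is_weak_partial (i : 'I_N) u g : Prop :=
  in_Lp 2 g /\ forall phi, test_function phi ->
    \int[mu]_(x in Omega) (u x * partial i phi x) =
    - \int[mu]_(x in Omega) (g x * phi x).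

Definition W12 u : Prop :=
  in_Lp 2 u /\ forall i, exists g, is_weak_partial i u g.

(** A representative of the weak derivative (unique a.e. when it exists). *)
Definition weak_partial (i : 'I_N) u : 'rV[R]_N -> R :=
  xget (cst 0) [set g | is_weak_partial i u g].

Definition grad_dot u v : 'rV[R]_N -> R :=
  fun x => \sum_(i < N) weak_partial i u x * weak_partial i v x.

(** The distance of the norm (\int_Omega |grad u|^2)^(1/2) of W^{1,2}_0. *)
Definition W012_dist u v : R :=
  Num.sqrt (\int[mu]_(x in Omega) grad_dot (u \- v) (u \- v) x).

(** The closure of the test functions in W^{1,2}(Omega). *)
Definition W012 u : Prop :=
  W12 u /\ forall e : R, 0 < e -> exists phi,
    [/\ test_function phi, Lp_dist 2 u phi < e & W012_dist u phi < e].

Definition rayleigh q phi : R :=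
  (\int[mu]_(x in Omega) grad_dot phi phi x +
   \int[mu]_(x in Omega) (q x * phi x ^+ 2)) /
  \int[mu]_(x in Omega) (phi x ^+ 2).

Definition lambda1 q : R :=
  inf [set rayleigh q phi | phi in
    [set phi | W012 phi /\ ~ (phi = cst 0 %[ae mu in Omega])]].

Definition is_qhat (p lambda : R) q0 q : Prop :=
  [/\ in_Lp p q, lambda = lambda1 q &
    Lp_dist p q0 q =
    inf [set Lp_dist p q0 r | r in
      [set r | lambda = lambda1 r /\ in_Lp p r]]].

Definition weak_positive_solution (p lambda : R) q0 u : Prop :=
  [/\ W012 u, \forall x \ae mu, Omega x -> 0 < u x &
    forall v, W012 v ->
      \int[mu]_(x in Omega) grad_dot u v x +
      \int[mu]_(x in Omega) (q0 x * u x * v x) =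
      lambda * \int[mu]_(x in Omega) (u x * v x) -
      \int[mu]_(x in Omega) (u x `^ ((p + 1) / (p - 1)) * v x)].

Definition is_uhat (p lambda : R) q0 q u : Prop :=
  weak_positive_solution p lambda q0 u /\
  \forall x \ae mu, Omega x -> q x = q0 x + u x `^ (2 / (p - 1)).

End spaces.

Definition admissible_exponent {R : realType} (N : nat) (p : R) : Prop :=
  [\/ (N < 4)%N /\ 2 <= p, N = 4 /\ 2 < p | (4 < N)%N /\ N%:R / 2 <= p].

(** Continuity on a subset, for sets equipped with (pseudo)distances. *)
Definition dist_continuous_on {R : realType} {X Y : Type} (dX : X -> X -> R)
    (dY : Y -> Y -> R) (D : set X) (f : X -> Y) : Prop :=
  forall x, D x -> forall e : R, 0 < e -> exists2 d : R, 0 < d &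
    forall y, D y -> dX x y < d -> dY (f x) (f y) < e.

(* Main.v *)
From HB Require Import structures.
Require Import Defs.
From mathcomp Require Import all_boot all_order all_algebra.
From mathcomp Require Import all_classical all_reals all_analysis.
From mathcomp Require Import measurable_realfun ring lra.

Set Implicit Arguments.
Unset Strict Implicit.
Unset Printing Implicit Defensive.

Import Order.TTheory GRing.Theory Num.Theory.
Import numFieldNormedType.Exports.

Local Open Scope classical_set_scope.
Local Open Scope ring_scope.

(** Write [V = q0 - lambda] and [a = qhat - q0 = uhat^(2/(p-1))]. The equation
    for [u = uhat] then reads [- Delta u + (V + a) u = 0], and [u^2 = a^(p-1)]
    lies in the space L^p' dual to L^p.

    Since [lambda1 qhat = lambda], the quadratic form of [- Delta + V + a] is
    nonnegative on the elements of W^{1,2}_0 whose square is in L^p'. Apply this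
    to the solution [w] of a second problem with data [V'] and [b]: as [w]
    annihilates the form of its own problem, one gets
    [0 <= \int ((V + a) - (V' + b)) w^2], and symmetrically with [u]. Adding up,
    [\int (a - b) (a^(p-1) - b^(p-1)) <= \int (V' - V) (u^2 - w^2)],
    and the left-hand side is at least [||a - b||_p^p] because [p >= 2]. Testing
    an equation with its own solution gives [||a||_p <= ||V||_p], so the
    right-hand side is controlled by [||V - V'||_p]: the map from [V] to [a] is
    continuous in L^p. The power inequalities then turn the smallness of [a - b]
    into that of [u^2 - w^2] in L^p', and the difference of the two equations,
    tested with [u] and with [w], bounds the gradient of [u - w] (lemmas
    [normp_da_le], [normp'_du2_le], [W012_dist_sqr_le]). The limit as [lambda]
    decreases to [lambda1 q0] comes from the energy inequality
    [\int a^p <= (lambda - lambda1 q0) \int u^2]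
    (lemma [normp_excess_le_lambda1]).

    Two facts make this work with the quantities as they are defined. First,
    [lambda1] is a genuine lower bound of the Rayleigh quotients
    ([rayleigh_has_lbound]). No Sobolev inequality is needed for this: it
    follows from the existence of nearest potentials. Secondly, weak derivatives are
    unique almost everywhere ([is_weak_partial_unique]), so that the gradient of
    [u - w] is the difference of the gradients. This is the fundamental lemma of
    the calculus of variations ([ae_eq0_test_function]), proved by testing with
    smooth functions, products of translates of [exp(-1/t)], that tend to the
    indicator of a box, followed by a monotone class argument. *)

(** * Boxes and Lebesgue measure on R^N *)

Section boxes.
Context {R : realType} {N : nat}.
Local Notation mu := (@lebesgue_rV R N).
Implicit Types (a b c x : 'rV[R]_N) (A : set 'rV[R]_N).

(** The open box of corners [a] and [b]. *)
Definition obox a b : set 'rV[R]_N := [set x | forall i, a 0 i < x 0 i < b 0 i].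

(** The closed box of corners [a] and [b]. *)
Definition cbox a b : set 'rV[R]_N :=
  [set x | forall i, a 0 i <= x 0 i <= b 0 i].

(** The open orthant of vertex [a]; the orthants form a pi-system. *)
Definition orthant a : set 'rV[R]_N := [set x | forall i, a 0 i < x 0 i].

Lemma measurable_coord_preimage (i : 'I_N) (Y : set R) :
  measurable (Y : set (measurableTypeR R)) ->
  measurable [set x : 'rV[R]_N | Y (x 0 i)].
Proof.
by move=> mY; have := measurable_coord i measurableT mY; rewrite setTI.
Qed.

Lemma measurable_forall_coord (Y : 'I_N -> set R) :
  (forall i, measurable (Y i : set (measurableTypeR R))) ->
  measurable [set x : 'rV[R]_N | forall i, Y i (x 0 i)].
Proof.
move=> mY.
have -> : [set x : 'rV[R]_N | forall i, Y i (x 0 i)] =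
    \bigcap_(i in [set: 'I_N]) [set x | Y i (x 0 i)].
  by apply/seteqP; split => x /= h i; [move=> _|]; apply: h.
apply: fin_bigcap_measurable; first exact: finite_finset.
by move=> i _; apply: measurable_coord_preimage.
Qed.

Lemma measurable_obox a b : measurable (obox a b).
Proof.
apply: (@measurable_forall_coord (fun i => [set t | a 0 i < t < b 0 i])) => i.
have -> : [set t | a 0 i < t < b 0 i] = `]a 0 i, b 0 i[%classic.
  by apply/seteqP; split => t /=; rewrite in_itv.
exact: measurable_itv.
Qed.

Lemma measurable_orthant a : measurable (orthant a).
Proof.
apply: (@measurable_forall_coord (fun i => [set t | a 0 i < t])) => i.
have -> : [set t | a 0 i < t] = `]a 0 i, +oo[%classic.
  by apply/seteqP; split => t /=; rewrite in_itv /= andbT.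
exact: measurable_itv.
Qed.

Lemma compact_cbox a b : compact (cbox a b).
Proof.
have -> : cbox a b = [set x : 'rV[R]_N | forall i, `[a 0 i, b 0 i]%classic (x 0 i)].
  by apply/seteqP; split => x /= h i; have := h i; rewrite in_itv.
apply: (@rV_compact R N (fun i => `[a 0 i, b 0 i]%classic)) => i.
exact: segment_compact.
Qed.

(** An open set is a countable union of open boxes whose closures it contains. *)
Lemma open_bigcup_obox A : open A ->
  exists D : set nat, exists F : nat -> 'rV[R]_N * 'rV[R]_N,
    (forall k, D k -> cbox (F k).1 (F k).2 `<=` A) /\
    A = \bigcup_(k in D) obox (F k).1 (F k).2.
Proof.
move=> oA.
(* boxes with rational corners, enumerated through a pickling of the corners *)
pose G (k : nat) : 'rV[R]_N * 'rV[R]_N :=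
  if @unpickle ('rV[rat]_N * 'rV[rat]_N)%type k is Some ab
  then (map_mx ratr ab.1, map_mx ratr ab.2)
  else (0, 0).
exists [set k | cbox (G k).1 (G k).2 `<=` A], G; split => //.
apply/seteqP; split => [x Ax|x [k /= kA] xk]; last first.
  by apply: kA => i; have /andP[/ltW -> /ltW ->] := xk i.
have [e /= e0 xeA] : exists2 e : R, 0 < e & ball x e `<=` A.
  by have /nbhs_ballP[e e0 xeA] := open_nbhs_nbhs (conj oA Ax); exists e.
have /choice[l lP] : forall i : 'I_N, exists q : rat, x 0 i - e < ratr q < x 0 i.
  move=> i; have [|q] := @rat_in_itvoo R (x 0 i - e) (x 0 i).
    by rewrite ltrBlDr ltrDl.
  by rewrite in_itv /= => ?; exists q.
have /choice[u uP] : forall i : 'I_N, exists q : rat, x 0 i < ratr q < x 0 i + e.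
  move=> i; have [|q] := @rat_in_itvoo R (x 0 i) (x 0 i + e).
    by rewrite ltrDl.
  by rewrite in_itv /= => ?; exists q.
exists (pickle (\row_i l i, \row_i u i)) => /=; rewrite /G pickleK /=.
  move=> y yP; apply: xeA; split => // j i; rewrite !ord1 /ball /=.
  have := yP i; rewrite !mxE => /andP[h1 h2].
  have /andP[h3 h4] := lP i; have /andP[h5 h6] := uP i.
  by rewrite ltr_norml; apply/andP; split; lra.
by move=> i; rewrite !mxE; have /andP[_ ->] := lP i; have /andP[-> _] := uP i.
Qed.

Lemma measurable_open_rV A : open A -> measurable A.
Proof.
move=> /open_bigcup_obox[D [F [_ ->]]].
by apply: bigcup_measurable => k _; exact: measurable_obox.
Qed.

End boxes.

Lemma lebesgue_obox_lty {R : realType} {N : nat} (a b : 'rV[R]_N) :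
  (lebesgue_rV N (obox a b) < +oo)%E.
Proof.
elim: N a b => [|n IH] a b.
  by rewrite /= diracE ltry.
have -> : obox a b = @obox R (1 + n)%N a b by [].
rewrite /= /lebesgue_rV_step /pushforward.
have -> : @rV_cons R n @^-1` (@obox R (1 + n)%N a b) =
    `]a 0 0, b 0 0[%classic `*`
    obox (@rsubmx _ 1 1 n a) (@rsubmx _ 1 1 n b).
  apply/seteqP; split => -[t v] /=.
    move=> h; split => [|i].
      have := h (lshift n ord0).
      rewrite /rV_cons row_mxEl mxE /= in_itv /=.
      by have -> : lshift n (@ord0 0) = 0 by apply/val_inj.
    by have := h (rshift 1 i); rewrite /rV_cons row_mxEr !mxE.
  rewrite in_itv /= => -[h1 h2] i; case: (split_ordP (i : 'I_(1 + n))) => j ->.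
    rewrite /rV_cons row_mxEl mxE (ord1 j).
    by have -> : lshift n (0 : 'I_1) = 0 by apply/val_inj.
  by have := h2 j; rewrite /rV_cons row_mxEr !mxE.
rewrite product_measure1E//; last exact: measurable_obox.
rewrite lte_mul_pinfty//.
rewrite ge0_fin_numE//.
change (lebesgue_measure `]a 0%R 0%R, b 0%R 0%R[%classic < +oo)%E.
rewrite lebesgue_measure_itv/=; case: ifP => // _.
by rewrite -EFinD ltry.
Qed.

Lemma lebesgue_bounded_lty {R : realType} {N : nat} (A : set 'rV[R]_N) :
  measurable A -> bounded_set A -> (lebesgue_rV N A < +oo)%E.
Proof.
move=> mA [M [_ /(_ (M + 1))]]; rewrite ltrDl ltr01 => /(_ isT) AM.
apply: le_lt_trans (lebesgue_obox_lty (const_mx (- (M + 2))) (const_mx (M + 2))).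
apply: le_measure; rewrite ?inE//; first exact: measurable_obox.
move=> x Ax i; rewrite !mxE.
have xi : `|x 0 i| <= M + 1.
  apply: le_trans (AM x Ax).
  rewrite [leRHS]/Num.norm /= mx_normrE; apply: (@le_bigmax_cond _ _ _ _ (0, i)) => //.
by move: xi; rewrite ler_norml => /andP[? ?]; apply/andP; split; lra.
Qed.

Lemma measurable_rV_orthantE {R : realType} {N : nat} :
  @measurable _ 'rV[R]_N = <<s range (@orthant R N) >>.
Proof.
apply/seteqP; split; last first.
  apply: smallest_sub; first exact: sigma_algebra_measurable.
  by move=> _ [a _ <-]; exact: measurable_orthant.
apply: smallest_sub; first exact: smallest_sigma_algebra.
move=> A; rewrite -bigcup_seq/= => -[i _ [B mB <-]].
have mi : measurable_fun [set: g_sigma_algebraType (range (@orthant R N))]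
    (fun x : 'rV[R]_N => x 0 i : measurableTypeR R).
  apply: (measurability _ (RGenOInfty.measurableE R)).
  move=> _ [_ [x ->] <-].
  rewrite setTI.
  (* a half-space is the union of the orthants whose other coordinates recede *)
  have -> : (fun x0 : 'rV[R]_N => x0 0 i) @^-1` `]x, +oo[%classic =
     \bigcup_(k : nat) orthant (\row_j if j == i then x else - k%:R).
    apply/seteqP; split => [y /=|y [k _ /(_ i)]]; last first.
      by rewrite mxE eqxx /= in_itv /= andbT.
    rewrite in_itv /= andbT => xy.
    exists (Num.bound (\sum_j `|y 0 j|)) => // j; rewrite mxE; case: eqP => [->//|_].
    have h : \sum_j `|y 0 j| < (Num.bound (\sum_j `|y 0 j|))%:R.
      by apply: archi_boundP; apply: sumr_ge0.
    rewrite ltrNl; apply: le_lt_trans h.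
    rewrite (bigD1 j)//= -normrN (le_trans (ler_norm _))// lerDl.
    by apply: sumr_ge0.
  apply: (@bigcupT_measurable _ (g_sigma_algebraType (range (@orthant R N)))) => k.
  by apply: sub_sigma_algebra; exists (\row_j if j == i then x else - k%:R).
by have := mi measurableT _ mB.
Qed.

(** * Integration and L^p norms over a measurable set *)

(** The L^p norm over [D], as a real number. It is locked so that unification
    does not compare two norms by unfolding integrals. *)
HB.lock Definition nrm {d} {T : measurableType d} {R : realType}
    (mu : {measure set T -> \bar R}) (D : set T) (p : R) (f : T -> R) : R :=
  (\int[mu]_(x in D) (`|f x| `^ p)) `^ p^-1.
Canonical locked_nrm := Unlockable nrm.unlock.

Section Lp_on_set.
Context d (T : measurableType d) (R : realType).
Variables (mu : {measure set T -> \bar R}) (D : set T).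
Hypothesis mD : measurable D.
Implicit Types (f g h : T -> R) (p q : R).

Lemma Rintegrable_abs f : mu.-integrable D (EFin \o f) ->
  mu.-integrable D (EFin \o (fun x => `|f x|)).
Proof. exact: integrable_norm. Qed.

Lemma RintegrableD f g : mu.-integrable D (EFin \o f) ->
  mu.-integrable D (EFin \o g) -> mu.-integrable D (EFin \o (fun x => f x + g x)).
Proof. by move=> fi gi; apply: eq_integrable (integrableD mD fi gi) => //. Qed.

Lemma RintegrableB f g : mu.-integrable D (EFin \o f) ->
  mu.-integrable D (EFin \o g) -> mu.-integrable D (EFin \o (fun x => f x - g x)).
Proof. by move=> fi gi; apply: eq_integrable (integrableB mD fi gi) => //. Qed.

Lemma RintegrableZ f (c : R) : mu.-integrable D (EFin \o f) ->
  mu.-integrable D (EFin \o (fun x => c * f x)).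
Proof. by move=> fi; apply: eq_integrable (integrableZl mD c fi) => //. Qed.

Lemma Rintegrable_measurable f : mu.-integrable D (EFin \o f) ->
  measurable_fun D f.
Proof. by move=> /measurable_int /measurable_EFinP. Qed.

Lemma ae_eq_Rintegral f g : measurable_fun D f -> measurable_fun D g ->
  (\forall x \ae mu, D x -> f x = g x) ->
  \int[mu]_(x in D) f x = \int[mu]_(x in D) g x.
Proof.
move=> mf mg fg; congr fine; apply: ae_eq_integral => //.
- exact/measurable_EFinP.
- exact/measurable_EFinP.
- by apply: filterS fg => x fg Dx; rewrite fg.
Qed.

Lemma ae_le_Rintegral f g : mu.-integrable D (EFin \o f) ->
  mu.-integrable D (EFin \o g) -> (\forall x \ae mu, D x -> f x <= g x) ->
  \int[mu]_(x in D) f x <= \int[mu]_(x in D) g x.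
Proof.
move=> fi gi fg; rewrite -subr_ge0 -RintegralB//.
have gfi := RintegrableB gi fi.
rewrite (@ae_eq_Rintegral _ (fun x => `|g x - f x|)).
- exact: Rintegral_ge0.
- exact: Rintegrable_measurable gfi.
- exact: Rintegrable_measurable (Rintegrable_abs gfi).
- by apply: filterS fg => x fg Dx; rewrite ger0_norm// subr_ge0 fg.
Qed.

Lemma ae_le_integrable f g : measurable_fun D f ->
  mu.-integrable D (EFin \o g) -> (\forall x \ae mu, D x -> `|f x| <= g x) ->
  mu.-integrable D (EFin \o f).
Proof.
move=> mf gi fg.
have mg := Rintegrable_measurable gi.
have mfg : measurable_fun D (fun x => Num.min `|f x| `|g x|).
  by apply: measurable_minr; exact: measurableT_comp.
have : mu.-integrable D (EFin \o (fun x => Num.min `|f x| `|g x|)).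
  apply: le_integrable gi => //; first exact/measurable_EFinP.
  move=> x Dx /=; rewrite lee_fin ger0_norm; last by rewrite le_min !normr_ge0.
  by rewrite ge_min lexx orbT.
move=> /integrableP[_ hoo]; apply/integrableP; split.
  exact/measurable_EFinP.
move: hoo; congr (_ < _)%E; apply: ae_eq_integral => //.
- by apply/measurable_EFinP; exact: measurableT_comp.
- by apply/measurable_EFinP; exact: measurableT_comp.
- apply: filterS fg => x fg Dx /=; congr EFin.
  rewrite (ger0_norm (x := Num.min _ _)); last by rewrite le_min !normr_ge0.
  by rewrite min_l// (le_trans (fg Dx))// ler_norm.
Qed.

Lemma Rintegral_abs_eq0 f : mu.-integrable D (EFin \o f) ->
  \int[mu]_(x in D) `|f x| = 0 -> \forall x \ae mu, D x -> f x = 0.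
Proof.
move=> fi f0.
have : (\int[mu]_(x in D) `|(EFin \o f) x|)%E = 0%E.
  have /integrable_fin_num fin := Rintegrable_abs fi.
  by rewrite -(fineK (fin mD)); congr EFin.
have mf : measurable_fun D (EFin \o f) by exact/measurable_EFinP/Rintegrable_measurable.
move=> /(@ae_eq_integral_abs _ _ _ mu D mD _ mf).
by apply: filterS => x /[apply] -[].
Qed.

(** The real integral of a nonintegrable measurable function is 0. *)
Lemma Rintegral_neq0_integrable f : measurable_fun D f ->
  \int[mu]_(x in D) f x != 0 -> mu.-integrable D (EFin \o f).
Proof.
move=> mf; rewrite /Rintegral => f0.
have fin : (\int[mu]_(x in D) (f x)%:E)%E \is a fin_num.
  by move: f0; case: (integral _ _ _) => //=; rewrite eqxx.
apply/integrableP; split; first exact/measurable_EFinP.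
by rewrite integral_fin_num_abs.
Qed.

(** ** The spaces L^p *)

(** The functions of [L^p D], defined on the whole space. *)
Definition inLp p f := (f \_ D) \in Lfun mu p%:E.

Local Notation nrm := (nrm mu D).

Lemma inLpP p f : 1 <= p -> inLp p f <->
  measurable_fun D f /\ mu.-integrable D (EFin \o (fun x => `|f x| `^ p)).
Proof.
move=> p1; have p0 : p != 0 by rewrite gt_eqF// (lt_le_trans ltr01).
have E : (fun x => (`|(f \_ D) x| `^ p)%:E) =
    (EFin \o (fun x => `|f x| `^ p)) \_ D.
  apply/funext => x; rewrite /patch; case: ifP => //=.
  by rewrite normr0 powR0.
split.
  move=> fp; have := Lfun_integrable p1 fp; rewrite E => /(integrable_mkcond _ mD) fi.
  split => //; move: fp; rewrite /inLp inE => /andP[/[!inE]/= mf _].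
  exact/(measurable_restrictT _ mD).
move=> [mf fi]; rewrite /inLp inE; apply/andP; split; rewrite inE/=.
  exact/(measurable_restrictT _ mD).
move/(integrable_mkcond _ mD): fi; rewrite -E => /integrableP[_].
rewrite /finite_norm unlock /= => h; apply: poweR_lty.
apply: le_lt_trans h; rewrite le_eqVlt; apply/orP; left; apply/eqP.
by apply: eq_integral => x _ /=; rewrite [in RHS]ger0_norm ?powR_ge0.
Qed.

Lemma inLp_measurable p f : 1 <= p -> inLp p f -> measurable_fun D f.
Proof. by move=> p1 /(inLpP _ p1)[]. Qed.

Lemma inLp_integrable p f : 1 <= p -> inLp p f ->
  mu.-integrable D (EFin \o (fun x => `|f x| `^ p)).
Proof. by move=> p1 /(inLpP _ p1)[]. Qed.

Lemma fine_LnormE p f : p != 0 ->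
  fine ('N[mu]_p%:E[EFin \o (f \_ D)])%E = nrm p f.
Proof.
move=> p0; rewrite nrm.unlock Lnorm.unlock fine_poweR; congr (_ `^ _).
rewrite [RHS]/Rintegral [in RHS]integral_mkcond; congr (fine _).
apply: eq_integral => x _ /=.
by rewrite /patch; case: ifP => //= _; rewrite normr0 powR0.
Qed.

Lemma nrm_ge0 p f : 0 <= nrm p f.
Proof. by rewrite unlock powR_ge0. Qed.

Lemma nrmK p f : p != 0 -> nrm p f `^ p = \int[mu]_(x in D) (`|f x| `^ p).
Proof.
move=> p0; rewrite unlock -powRrM mulVf// powRr1//.
by apply: Rintegral_ge0 => x _; exact: powR_ge0.
Qed.

Lemma eq_nrm p f g : (forall x, D x -> `|f x| = `|g x|) -> nrm p f = nrm p g.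
Proof.
move=> fg; rewrite unlock; congr (_ `^ _).
by apply: eq_Rintegral => x /set_mem Dx; rewrite fg.
Qed.

Lemma nrmN p f : nrm p (fun x => - f x) = nrm p f.
Proof. by apply: eq_nrm => x _; rewrite normrN. Qed.

Lemma nrm_cst p (c : R) : p != 0 -> nrm p (cst c) = `|c| * nrm p (cst 1).
Proof.
move=> p0; rewrite unlock /= !Rintegral_cst// normr1 powR1 mul1r.
by rewrite powRM ?powR_ge0 ?fine_ge0// -powRrM mulfV// powRr1.
Qed.

Lemma nrm_lt p f (e : R) : 0 < p -> 0 < e ->
  \int[mu]_(x in D) (`|f x| `^ p) < e `^ p -> nrm p f < e.
Proof.
move=> p0 e0 h; rewrite unlock; have -> : e = (e `^ p) `^ p^-1.
  by rewrite -powRrM mulfV ?gt_eqF// powRr1// ltW.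
apply: gt0_ltr_powR => //.
- by rewrite invr_gt0.
- by rewrite nnegrE; apply: Rintegral_ge0 => x _; exact: powR_ge0.
- by rewrite nnegrE powR_ge0.
Qed.

Lemma nrm_powR p q f g :
  \int[mu]_(x in D) (`|f x| `^ q) = \int[mu]_(x in D) (`|g x| `^ p) ->
  p != 0 -> nrm q f = nrm p g `^ (p / q).
Proof. by move=> fg p0; rewrite unlock fg -powRrM mulKf. Qed.

Lemma inLpD p f g : 1 <= p -> inLp p f -> inLp p g ->
  inLp p (fun x => f x + g x).
Proof.
move=> p1 fp gp; rewrite /inLp.
have -> : (fun x => f x + g x) \_ D = f \_ D + g \_ D.
  by apply/funext => x; rewrite /patch /= /GRing.add /=; case: ifP => //; rewrite addr0.
by have [_ h] := @Lfun_addr_closed _ _ _ mu p%:E p1; apply: h.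
Qed.

Lemma inLpN p f : 1 <= p -> inLp p f -> inLp p (fun x => - f x).
Proof.
move=> p1 fp; rewrite /inLp.
have -> : (fun x => - f x) \_ D = - (f \_ D).
  by apply/funext => x; rewrite /patch /= /GRing.opp /=; case: ifP => //; rewrite oppr0.
exact: Lfun_oppr_closed.
Qed.

Lemma inLpB p f g : 1 <= p -> inLp p f -> inLp p g ->
  inLp p (fun x => f x - g x).
Proof. by move=> p1 fp gp; apply: inLpD => //; exact: inLpN. Qed.

Lemma ae_le_inLp p f g : 1 <= p -> measurable_fun D f -> inLp p g ->
  (\forall x \ae mu, D x -> `|f x| <= `|g x|) -> inLp p f.
Proof.
move=> p1 mf gp fg; apply/inLpP => //; split => //.
have p0 : 0 <= p by rewrite (le_trans ler01).
apply: ae_le_integrable (inLp_integrable p1 gp) _.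
  by apply: (measurableT_comp (measurable_powR _)); exact: measurableT_comp.
apply: filterS fg => x fg Dx; rewrite ger0_norm ?powR_ge0//.
by apply: ge0_ler_powR => //; rewrite ?nnegrE ?fg.
Qed.

Lemma nrmD p f g : 1 <= p -> inLp p f -> inLp p g ->
  nrm p (fun x => f x + g x) <= nrm p f + nrm p g.
Proof.
move=> p1 fp gp; have p0 : p != 0 by rewrite gt_eqF// (lt_le_trans ltr01).
have fgp := inLpD p1 fp gp.
rewrite -!fine_LnormE//.
have fin h : inLp p h -> ('N[mu]_p%:E[EFin \o (h \_ D)])%E \is a fin_num.
  rewrite /inLp inE => /andP[_]; rewrite inE /= /finite_norm => hoo.
  by rewrite ge0_fin_numE// Lnorm_ge0.
rewrite -fineD ?fin// fine_le ?fin_numD ?fin//.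
have -> : (fun x => f x + g x) \_ D = (f \_ D \+ g \_ D).
  by apply/funext => x; rewrite /patch /=; case: ifP => //; rewrite addr0.
apply: minkowski => //.
- by apply/(measurable_restrictT _ mD); exact: inLp_measurable fp.
- by apply/(measurable_restrictT _ mD); exact: inLp_measurable gp.
Qed.

Lemma nrmB p f g : 1 <= p -> inLp p f -> inLp p g ->
  nrm p (fun x => f x - g x) <= nrm p f + nrm p g.
Proof. by move=> p1 fp gp; rewrite -(nrmN p g); apply: nrmD => //; exact: inLpN. Qed.

Lemma nrm_normB p f g : nrm p (fun x => f x - g x) = nrm p (fun x => g x - f x).
Proof. by apply: eq_nrm => x _; rewrite distrC. Qed.

Lemma nrm_le_addB p f g : 1 <= p -> inLp p f -> inLp p g ->
  nrm p g <= nrm p f + nrm p (fun x => f x - g x).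
Proof.
move=> p1 fp gp; rewrite nrm_normB.
apply: le_trans (nrmD p1 fp (inLpB p1 gp fp)).
by rewrite le_eqVlt (@eq_nrm _ g (fun x => f x + (g x - f x))) ?eqxx// => x _;
  rewrite addrC subrK.
Qed.

Lemma hoelder_integrable p q f g : 1 <= p -> 1 <= q -> p^-1 + q^-1 = 1 ->
  inLp p f -> inLp q g -> mu.-integrable D (EFin \o (fun x => f x * g x)).
Proof.
move=> p1 q1 pq fp gq.
have p0 : 0 < p by rewrite (lt_le_trans ltr01).
have q0 : 0 < q by rewrite (lt_le_trans ltr01).
apply: (@ae_le_integrable _ (fun x => `|f x| `^ p / p + `|g x| `^ q / q)).
- by apply: measurable_funM; [exact: inLp_measurable fp|exact: inLp_measurable gq].
- apply: RintegrableD.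
    have := RintegrableZ p^-1 (inLp_integrable p1 fp).
    by apply: eq_integrable => // x _ /=; rewrite mulrC.
  have := RintegrableZ q^-1 (inLp_integrable q1 gq).
  by apply: eq_integrable => // x _ /=; rewrite mulrC.
- by apply: aeW => x _; rewrite normrM; apply: conjugate_powR.
Qed.

Lemma hoelder_nrm p q f g : 1 <= p -> 1 <= q -> p^-1 + q^-1 = 1 ->
  inLp p f -> inLp q g ->
  \int[mu]_(x in D) `|f x * g x| <= nrm p f * nrm q g.
Proof.
move=> p1 q1 pq fp gq.
have p0 : 0 < p by rewrite (lt_le_trans ltr01).
have q0 : 0 < q by rewrite (lt_le_trans ltr01).
have mf : measurable_fun setT (f \_ D).
  by apply/(measurable_restrictT _ mD); exact: inLp_measurable fp.
have mg : measurable_fun setT (g \_ D).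
  by apply/(measurable_restrictT _ mD); exact: inLp_measurable gq.
have fin r h : inLp r h -> ('N[mu]_r%:E[EFin \o (h \_ D)])%E \is a fin_num.
  rewrite /inLp inE => /andP[_]; rewrite inE /= /finite_norm => hoo.
  by rewrite ge0_fin_numE// Lnorm_ge0.
have := hoelder mu mf mg p0 q0 pq.
rewrite -!fine_LnormE ?gt_eqF// Lnorm1.
have -> : (\int[mu]_x `|(EFin \o (f \_ D \* g \_ D)%R) x|)%E =
    (\int[mu]_(x in D) (`|f x * g x|)%:E)%E.
  rewrite [RHS]integral_mkcond; apply: eq_integral => x _ /=.
  by rewrite /patch; case: ifP => //= _; rewrite mulr0 normr0.
have /integrable_fin_num fi := Rintegrable_abs (hoelder_integrable p1 q1 pq fp gq).
rewrite -lee_fin EFinM !fineK ?fin//; exact: fi.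
Qed.

Lemma hoelder_le p q f g : 1 <= p -> 1 <= q -> p^-1 + q^-1 = 1 ->
  inLp p f -> inLp q g ->
  \int[mu]_(x in D) (f x * g x) <= nrm p f * nrm q g.
Proof.
move=> p1 q1 pq fp gq; apply: le_trans (hoelder_nrm p1 q1 pq fp gq).
have fgi := hoelder_integrable p1 q1 pq fp gq.
apply: ae_le_Rintegral => //; first exact: Rintegrable_abs.
by apply: aeW => x _; exact: ler_norm.
Qed.

End Lp_on_set.

(** * Smooth bump functions *)

Section flat.
Context {R : realType}.
Implicit Types (P : {poly R}) (t s : R).

(** The functions P(1/t) exp(-1/t) for t > 0, extended by 0: a family of
    functions flat at 0, stable under derivation. *)
Definition flat P t : R := if 0 < t then P.[t^-1] * expR (- t^-1) else 0.

(** The polynomial of the derivative of [flat P]. *)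
Definition flat_deriv P : {poly R} := 'X^2 * (P - P^`()).

Lemma poly_le_expR P (k : R) : 0 < k ->
  exists2 C : R, 0 <= C & forall s, 0 <= s -> `|P.[s]| <= C * expR (k * s).
Proof.
(* the exponent is halved at each step, to absorb one more factor s *)
elim/poly_ind: P k => [|P c IH] k k0.
  by exists 0 => // s _; rewrite horner0 normr0 mul0r.
have k20 : 0 < k / 2 by rewrite divr_gt0.
have [C C0 CP] := IH _ k20.
exists (C * (k / 2)^-1 + `|c|) => [|s s0].
  by rewrite addr_ge0// mulr_ge0// invr_ge0 ltW.
rewrite hornerMXaddC mulrDl; apply: le_trans (ler_normD _ _) _.
apply: lerD; last first.
  rewrite ler_peMr// (le_trans _ (expR_ge1Dx _))// lerDl.
  by rewrite mulr_ge0// ltW.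
rewrite normrM (ger0_norm s0).
have -> : k * s = k / 2 * s + k / 2 * s by field.
rewrite expRD.
have -> : C / (k / 2) * (expR (k / 2 * s) * expR (k / 2 * s)) =
  C * expR (k / 2 * s) * ((k / 2)^-1 * expR (k / 2 * s)) by ring.
apply: ler_pM => //; first exact: CP.
rewrite ler_pdivlMl//.
by apply: le_trans (expR_ge1Dx _); rewrite lerDr.
Qed.

Lemma flat_le P : exists2 C : R, 0 <= C & forall t, `|flat P t| <= C * t ^+ 2.
Proof.
have [C C0 CP] := @poly_le_expR (P * 'X^2) 1 ltr01.
exists C => // t; rewrite /flat; case: ifP => t0; last first.
  by rewrite normr0 mulr_ge0// sqr_ge0.
have ti0 : 0 <= t^-1 by rewrite invr_ge0 ltW.
have := CP _ ti0; rewrite hornerM hornerXn mul1r normrM.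
rewrite (ger0_norm (exprn_ge0 _ ti0)) => h.
rewrite normrM (ger0_norm (expR_ge0 _)) expRN ler_pdivrMr ?expR_gt0//.
by rewrite mulrAC -ler_pdivrMr ?exprn_gt0// -exprVn.
Qed.

Lemma is_derive_flat P t : is_derive t (1 : R) (flat P) (flat (flat_deriv P) t).
Proof.
have [t0|t0|->] := ltgtP t 0.
- apply: (@near_eq_is_derive _ _ _ (cst 0)).
    near=> u; rewrite /flat /= ltNge ltW//=.
    near: u; exact: lt_nbhsl.
  by rewrite /flat ltNge ltW//=; exact: is_derive_cst.
- have iV : is_derive t (1 : R) (fun u : R => u^-1) (- t ^- 2).
    apply: is_derive_eq; first by apply: is_deriveV; rewrite gt_eqF.
    by rewrite /GRing.scale /= mulr1.
  have iP : is_derive t (1 : R) (fun u : R => P.[u^-1])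
      (P^`().[t^-1] * - t ^- 2).
    exact: (@is_derive1_comp _ (horner P) GRing.inv t _ _ (is_derive_poly P t^-1) iV).
  have iE : is_derive t (1 : R) (fun u : R => expR (- u^-1)) (expR (- t^-1) * t ^- 2).
    have iN : is_derive t (1 : R) (fun u : R => - u^-1) (t ^- 2).
      by have := is_deriveN iV; rewrite opprK.
    exact: (@is_derive1_comp _ (@expR R) (fun u => - u^-1) t _ _ (is_derive_expR _) iN).
  apply: (near_eq_is_derive (f := fun u : R => P.[u^-1] * expR (- u^-1))).
    near=> u; rewrite /flat ifT//.
    near: u; exact: lt_nbhsr.
  have iM := is_deriveM iP iE.
  apply: (is_derive_eq iM).
  rewrite /flat t0 /flat_deriv !hornerE /GRing.scale /= exprVn.
  by ring.
- have [C C0 CP] := flat_le P.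
  have E0 : flat P 0 = 0 by rewrite /flat ltxx.
  have -> : flat (flat_deriv P) 0 = 0 by rewrite /flat ltxx.
  suff h : h^-1 *: ((flat P \o shift 0) (h *: (1 : R)) - flat P 0)
      @[h --> 0^'] --> (0 : R).
    by split; [apply/cvg_ex; exists 0|exact: cvg_lim].
  apply/cvgr0Pnorm_lt => e e0.
  near=> h.
  have h0 : h != 0 by near: h; exact: nbhs_dnbhs_neq.
  rewrite /= E0 subr0 addr0 [h *: 1]mulr1 /GRing.scale /= normrM normfV.
  rewrite ltr_pdivrMl ?normr_gt0//.
  apply: le_lt_trans (CP _) _; rewrite -real_normK ?num_real//.
  rewrite exprS expr1 mulrCA ltr_pM2l ?normr_gt0//.
  have hC : `|h| < e / (C + 1).
    near: h; by apply: dnbhs0_lt; rewrite divr_gt0// ltr_wpDl.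
  apply: (@le_lt_trans _ _ ((C + 1) * `|h|)).
    by rewrite ler_wpM2r// lerDl.
  by rewrite mulrC -ltr_pdivlMr// ltr_wpDl.
Unshelve. all: by end_near. Qed.

End flat.

Section bumps.
Context {R : realType} {N : nat}.
Implicit Types (f g : 'rV[R]_N -> R).

(** The algebra generated by the functions x |-> flat P (c x_i + d). *)
Inductive flat_alg : ('rV[R]_N -> R) -> Prop :=
| flat_alg_cst c : flat_alg (cst c)
| flat_alg_flat P (c d : R) i : flat_alg (fun x => flat P (c * x 0 i + d))
| flat_algD f g : flat_alg f -> flat_alg g -> flat_alg (f + g)
| flat_algM f g : flat_alg f -> flat_alg g -> flat_alg (f * g).

Lemma differentiable_affine_coord (c d : R) (i : 'I_N) (x : 'rV[R]_N) :
  differentiable (fun y : 'rV[R]_N => c * y 0 i + d) x.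
Proof.
apply: differentiableD; last exact: differentiable_cst.
apply: differentiableM; first exact: differentiable_cst.
exact: differentiable_coord.
Qed.

Lemma derive_affine_coord (c d : R) (i : 'I_N) (x v : 'rV[R]_N) :
  'D_v (fun y : 'rV[R]_N => c * y 0 i + d) x = c * v 0 i.
Proof.
apply: cvg_lim => //; apply: cvg_near_cst; near=> h.
have h0 : h != 0 by near: h; exact: nbhs_dnbhs_neq.
rewrite /= !mxE /GRing.scale /=.
by field.
Unshelve. all: by end_near. Qed.

Lemma differentiable_flat_coord P (c d : R) (i : 'I_N) (x : 'rV[R]_N) :
  differentiable (fun y : 'rV[R]_N => flat P (c * y 0 i + d)) x.
Proof.
apply: (@differentiable_comp _ _ _ _ (fun y : 'rV[R]_N => c * y 0 i + d) (flat P)).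
  exact: differentiable_affine_coord.
by apply/derivable1_diffP; have [] := is_derive_flat P (c * x 0 i + d).
Qed.

Lemma partial_flat_coord P (c d : R) (i j : 'I_N) :
  partial j (fun y : 'rV[R]_N => flat P (c * y 0 i + d)) =
  cst (c * (i == j)%:R) * (fun y => flat (flat_deriv P) (c * y 0 i + d)).
Proof.
apply/funext => x; rewrite /partial.
pose l := fun y : 'rV[R]_N => c * y 0 i + d.
have dl : differentiable l x by exact: differentiable_affine_coord.
have [df fE] := is_derive_flat P (l x).
have dlf : differentiable (flat P) (l x) by exact/derivable1_diffP.
rewrite deriveE; last exact: differentiable_flat_coord.
rewrite (@diff_comp _ _ _ _ l (flat P))//= (deriv1E df) derive1E fE.
rewrite -(deriveE _ dl) derive_affine_coord mxE eqxx /= eq_sym.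
by rewrite /GRing.mul /= /GRing.scale /=.
Qed.

Lemma flat_alg_partial f : flat_alg f ->
  (forall x, differentiable f x) /\ forall j, flat_alg (partial j f).
Proof.
elim=> {f} [c|P c d i|f g _ [df pf] _ [dg pg]|f g sf [df pf] sg [dg pg]].
- split=> [x|j]; first exact: differentiable_cst.
  have -> : partial j (cst c) = cst 0 by apply/funext => x; exact: derive_cst.
  exact: flat_alg_cst.
- split=> [x|j]; first exact: differentiable_flat_coord.
  rewrite partial_flat_coord; apply: flat_algM; first exact: flat_alg_cst.
  exact: flat_alg_flat.
- split=> [x|j]; first exact: differentiableD.
  have -> : partial j (f + g) = partial j f + partial j g.
    by apply/funext => x; rewrite /partial deriveD//; exact: diff_derivable.
  exact: flat_algD.
- split=> [x|j]; first exact: differentiableM.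
  have -> : partial j (f * g) = f * partial j g + g * partial j f.
    by apply/funext => x; rewrite /partial deriveM//; exact: diff_derivable.
  by apply: flat_algD; apply: flat_algM.
Qed.

Lemma flat_alg_foldr_partial f (s : seq 'I_N) x : flat_alg f ->
  differentiable (foldr partial f s) x.
Proof.
move=> sf; have : flat_alg (foldr partial f s).
  by elim: s => //= j s /flat_alg_partial[_]; exact.
by move=> /flat_alg_partial[].
Qed.

Lemma flat_alg_prod (F : 'I_N -> 'rV[R]_N -> R) (s : seq 'I_N) :
  (forall i, flat_alg (F i)) -> flat_alg (fun x => \prod_(i <- s) F i x).
Proof.
move=> sF; elim: s => [|i s IH].
  have -> : (fun x => \prod_(i <- [::]) F i x) = cst 1.
    by apply/funext => x; rewrite big_nil.
  exact: flat_alg_cst.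
have -> : (fun x => \prod_(j <- i :: s) F j x) =
    F i * (fun x => \prod_(j <- s) F j x).
  by apply/funext => x; rewrite big_cons.
exact: flat_algM.
Qed.

(** A smooth approximation, from below, of the indicator of the box
    [obox a b]; it tends to this indicator as [k] grows. *)
Definition bump (k : nat) (a b : 'rV[R]_N) (x : 'rV[R]_N) : R :=
  \prod_i (flat 1 (k%:R * x 0 i + - (k%:R * a 0 i)) *
           flat 1 (- k%:R * x 0 i + k%:R * b 0 i)).

Lemma flat1_itv (t : R) : 0 <= flat 1 t <= 1.
Proof.
rewrite /flat; case: ifP => t0; last by rewrite lexx ler01.
by rewrite hornerC mul1r expR_ge0 expR_le1 oppr_le0 invr_ge0 ltW.
Qed.

Lemma bump_ge0 k a b x : 0 <= bump k a b x.
Proof.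
apply: prodr_ge0 => i _; rewrite mulr_ge0//.
- by have /andP[] := flat1_itv (k%:R * x 0 i + - (k%:R * a 0 i)).
- by have /andP[] := flat1_itv (- k%:R * x 0 i + k%:R * b 0 i).
Qed.

Lemma bump_le1 k a b x : bump k a b x <= 1.
Proof.
rewrite -[leRHS](@big1_eq _ 1 *%R 'I_N (index_enum 'I_N) xpredT).
apply: ler_prod => i _.
have /andP[? ?] := flat1_itv (k%:R * x 0 i + - (k%:R * a 0 i)).
have /andP[? ?] := flat1_itv (- k%:R * x 0 i + k%:R * b 0 i).
by rewrite mulr_ge0//= mulr_ile1.
Qed.

Lemma bump_out k a b x : ~ obox a b x -> bump k a b x = 0.
Proof.
move=> /existsNP[i xi]; rewrite /bump (bigD1 i)//= /flat.
have k0 : 0 <= k%:R :> R by [].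
case: ifP => [h1|_]; last by rewrite !mul0r.
case: ifP => [h2|_]; last by rewrite mulr0 mul0r.
exfalso; apply: xi; apply/andP; split.
  by rewrite ltNge; apply/negP => h; have := ler_wpM2l k0 h; lra.
by rewrite ltNge; apply/negP => h; have := ler_wpM2l k0 h; lra.
Qed.

Lemma cvg_flat1 (t : R) : 0 < t -> flat 1 (k%:R * t) @[k --> \oo] --> (1 : R).
Proof.
move=> t0.
have h : expR (- (t^-1 * k.+1%:R^-1)) @[k --> \oo] --> (1 : R).
  rewrite -[X in _ --> X]expR0 -[X in _ --> expR X]oppr0.
  apply: (cvg_comp _ expR); last exact: continuous_expR.
  apply: cvgN; rewrite -[X in _ --> X](mulr0 t^-1).
  by apply: cvgM; [exact: cvg_cst|exact: cvg_harmonic].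
rewrite -cvg_shiftS; apply: cvg_trans h; apply: near_eq_cvg.
apply: nearW => k /=; rewrite /flat ifT ?mulr_gt0// hornerC mul1r.
by rewrite invfM mulrC.
Qed.

Lemma cvg_bump a b x : obox a b x -> bump k a b x @[k --> \oo] --> (1 : R).
Proof.
move=> xab; rewrite /bump -[X in _ --> X](@big1_eq _ 1 *%R 'I_N (index_enum 'I_N) xpredT).
elim: (index_enum _) => [|i s IH].
  by rewrite big_nil; under eq_fun do rewrite big_nil; exact: cvg_cst.
rewrite big_cons; under eq_fun do rewrite big_cons.
apply: cvgM => //; rewrite -[X in _ --> X]mulr1.
have /andP[h1 h2] := xab i.
apply: cvgM.
  under eq_fun do rewrite -mulrBr.
  by apply: cvg_flat1; rewrite subr_gt0.
under eq_fun do rewrite mulNr -mulrN -mulrDr.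
by apply: cvg_flat1; rewrite addrC subr_gt0.
Qed.

Lemma flat_alg_bump k a b : flat_alg (bump k a b).
Proof.
apply: flat_alg_prod => i.
apply: (@flat_algM (fun x => flat 1 (k%:R * x 0 i + - (k%:R * a 0 i)))
  (fun x => flat 1 (- k%:R * x 0 i + k%:R * b 0 i))).
  exact: flat_alg_flat.
exact: flat_alg_flat.
Qed.

Lemma test_function_bump (Omega : set 'rV[R]_N) k a b :
  cbox a b `<=` Omega -> test_function Omega (bump k a b).
Proof.
move=> abO; split=> [s x|].
  exact: flat_alg_foldr_partial (flat_alg_bump k a b).
exists (cbox a b); split => //; first exact: compact_cbox.
move=> x xab; apply: bump_out => h; apply: xab => i.
by have /andP[/ltW -> /ltW ->] := h i.
Qed.

Lemma measurable_continuous_rV f : continuous f -> measurable_fun setT f.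
Proof.
move=> cf; apply: (measurability _ (RGenOpens.measurableE R)).
move=> _ [_ [u [v ->]] <-]; rewrite setTI; apply: measurable_open_rV.
by move/continuousP : cf; apply; exact: interval_open.
Qed.

Lemma measurable_bump k a b : measurable_fun setT (bump k a b).
Proof.
apply: measurable_continuous_rV => x; apply: differentiable_continuous.
by have [] := flat_alg_partial (flat_alg_bump k a b).
Qed.

End bumps.

(** * The fundamental lemma of the calculus of variations *)

Section fundamental_lemma.
Context {R : realType} {N : nat}.
Local Notation mu := (@lebesgue_rV R N).
Implicit Types (Omega : set 'rV[R]_N) (h : 'rV[R]_N -> R) (a b : 'rV[R]_N).

Lemma obox_sub_cbox a b : obox a b `<=` cbox a b.
Proof. by move=> x xab i; have /andP[/ltW -> /ltW ->] := xab i. Qed.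

(** The indicator of the box is a bounded limit of test functions. *)
Lemma integral_obox_eq0 Omega h a b : measurable Omega ->
  mu.-integrable Omega (EFin \o h) ->
  (forall phi, test_function Omega phi ->
    \int[mu]_(x in Omega) (h x * phi x) = 0) ->
  cbox a b `<=` Omega ->
  (\int[mu]_(x in obox a b) (h x)%:E = 0)%E.
Proof.
move=> mO hi h0 abO.
have mh := Rintegrable_measurable hi.
have mb k : measurable_fun Omega (bump k a b).
  by apply: measurable_funS (measurable_bump k a b).
have h0E k : (\int[mu]_(x in Omega) (h x * bump k a b x)%:E = 0)%E.
  have h0k := h0 _ (test_function_bump k abO).
  have hbi : mu.-integrable Omega (EFin \o (fun x => h x * bump k a b x)).
    apply: (ae_le_integrable mO _ (Rintegrable_abs hi)).
      exact: measurable_funM.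
    apply: aeW => x _; rewrite normrM (ger0_norm (bump_ge0 _ _ _ _)).
    by rewrite ler_piMr// bump_le1.
  transitivity ((\int[mu]_(x in Omega) (h x * bump k a b x))%:E).
    by rewrite /Rintegral fineK//; exact: (integrable_fin_num mO hbi).
  by rewrite h0k.
have := @dominated_convergence _ _ _ mu Omega mO
  (fun k x => (h x * bump k a b x)%:E)
  ((EFin \o h) \_ (obox a b)) (fun x => (`|h x|)%:E).
case.
- by move=> k; apply/measurable_EFinP; exact: measurable_funM.
- apply/measurable_restrict => //; first exact: measurable_obox.
  by apply/measurable_EFinP; apply: measurable_funS mh.
- apply: aeW => x Ox; rewrite /patch; case: ifPn => [xab|/negP xab].
    apply: cvg_EFin; first exact: nearW.
    rewrite /comp /= -[X in _ --> X]mulr1; apply: cvgM; first exact: cvg_cst.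
    by apply: cvg_bump; exact: set_mem.
  apply: cvg_near_cst; apply: nearW => k; rewrite bump_out ?mulr0// => H.
  by apply: xab; rewrite inE.
- exact: Rintegrable_abs.
- apply: aeW => x k Ox /=; rewrite lee_fin normrM (ger0_norm (bump_ge0 _ _ _ _)).
  by rewrite ler_piMr// bump_le1.
move=> _ _ ; under eq_fun do rewrite h0E.
move=> /cvg_lim; rewrite lim_cst// => /(_ _)/esym.
rewrite -integral_mkcondr setIidr; first by apply.
exact: subset_trans (@obox_sub_cbox a b) abO.
Qed.

Lemma oboxI a b c : obox a b `&` orthant c =
  obox (\row_i Num.max (a 0 i) (c 0 i)) b.
Proof.
apply/seteqP; split => x.
  by move=> [xab xc] i; rewrite mxE gt_max xc; have /andP[-> ->] := xab i.
move=> h; split => i; have := h i; rewrite mxE gt_max => /andP[/andP[h1 h2] h3] //.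
by rewrite h1.
Qed.

(** A Dynkin induction from the traces of orthants on the box, which are
    boxes. *)
Lemma ae_eq0_obox h a b : mu.-integrable (obox a b) (EFin \o h) ->
  (forall a', (forall i, a 0 i <= a' 0 i) ->
    (\int[mu]_(x in obox a' b) (h x)%:E = 0)%E) ->
  \forall x \ae mu, obox a b x -> h x = 0.
Proof.
move=> hi h0; have mB : measurable (obox a b) by exact: measurable_obox.
have hB0 A : measurable A -> (\int[mu]_(x in obox a b `&` A) (h x)%:E = 0)%E.
  rewrite measurable_rV_orthantE; move: A.
  apply: (@dynkin_induction _ _ (range (@orthant R N))
    [set A | (\int[mu]_(x in obox a b `&` A) (h x)%:E = 0)%E]).
  - exact: measurable_rV_orthantE.
  - move=> _ _ [c _ <-] [c' _ <-]; exists (\row_i Num.max (c 0 i) (c' 0 i)) => //.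
    apply/seteqP; split => x.
      by move=> h1; split => i; have := h1 i; rewrite mxE gt_max => /andP[].
    by move=> [h1 h2] i; rewrite mxE gt_max h1 h2.
  - by rewrite /= setIT; apply: h0.
  - move=> _ [c _ <-] /=; rewrite oboxI; apply: h0 => i.
    by rewrite mxE le_max lexx.
  - move=> A mA /= A0.
    have := h0 a (fun i => lexx _).
    rewrite -{1}(setIT (obox a b)) -(setUv A) setIUr integral_setU_EFin//.
    + by rewrite A0 add0e.
    + exact: measurableI.
    + by apply: measurableI => //; exact: measurableC.
    + rewrite -setIUr setUv setIT; apply: Rintegrable_measurable.
      exact: hi.
    + by apply/disj_setPS => x [[_ ?] [_ ?]].
  - move=> F mF tF /= F0; rewrite setI_bigcupr integral_bigcup//.
    + by rewrite eseries0// => k _ _; exact: F0.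
    + exact: trivIset_setIl.
    + by move=> k; exact: measurableI.
    + rewrite -setI_bigcupr; apply: integrableS hi => //.
      by apply: measurableI => //; exact: bigcupT_measurable.
have h00 : ae_eq mu (obox a b) (EFin \o h) (cst 0%E).
  apply: integral_ae_eq => // E EB mE; rewrite integral0.
  by have := hB0 _ mE; rewrite setIidr.
by apply: filterS h00 => x /[apply] -[].
Qed.

(** Fundamental lemma of the calculus of variations. *)
Lemma ae_eq0_test_function Omega h : open Omega ->
  mu.-integrable Omega (EFin \o h) ->
  (forall phi, test_function Omega phi ->
    \int[mu]_(x in Omega) (h x * phi x) = 0) ->
  \forall x \ae mu, Omega x -> h x = 0.
Proof.
move=> oO hi h0; have mO := measurable_open_rV oO.
have [D [F [FO OE]]] := open_bigcup_obox oO.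
have hF k : D k -> \forall x \ae mu, obox (F k).1 (F k).2 x -> h x = 0.
  move=> Dk; apply: ae_eq0_obox => [|a' aa'].
    apply: integrableS hi => //; first exact: measurable_obox.
    exact: subset_trans (@obox_sub_cbox _ _) (FO _ Dk).
  apply: (integral_obox_eq0 mO hi h0) => x xa; apply: (FO _ Dk) => i.
  by have /andP[h1 ->] := xa i; rewrite (le_trans (aa' i)).
have {}hF : \forall x \ae mu, forall k, D k -> obox (F k).1 (F k).2 x -> h x = 0.
  apply/ae_foralln => k; have [Dk|nDk] := pselect (D k).
    by apply: filterS (hF _ Dk) => x hx _.
  by apply: aeW => x /nDk.
by apply: filterS hF => x hx; rewrite {1}OE => -[k Dk]; exact: hx.
Qed.

End fundamental_lemma.

(** * Elementary inequalities for real powers *)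

Section power_inequalities.
Context {R : realType}.
Implicit Types (a b x y p r : R).

Lemma powR_superadditive x y r : 0 <= y -> y <= x -> 1 <= r ->
  (x - y) `^ r <= x `^ r - y `^ r.
Proof.
move=> y0 yx r1.
have x0 : 0 <= x := le_trans y0 yx.
have r0 : 0 < r by rewrite (lt_le_trans ltr01).
have r10 : 0 <= r - 1 by rewrite subr_ge0.
have le_mul z : 0 <= z -> z <= x -> z `^ r <= z * x `^ (r - 1).
  move=> z0 zx; rewrite -mulr_powRB1//; apply: ler_wpM2l => //.
  by apply: ge0_ler_powR; rewrite ?nnegrE.
rewrite lerBrDr -[leRHS](mulr_powRB1 x0 r0).
have -> : x * x `^ (r - 1) = (x - y) * x `^ (r - 1) + y * x `^ (r - 1) by ring.
by apply: lerD; apply: le_mul; rewrite ?subr_ge0// gerBl.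
Qed.

Lemma ler_powRB_norm p a b : 1 < p -> 0 <= a -> 0 <= b ->
  `|a `^ p - b `^ p| <= p * (`|a - b| * (a + b) `^ (p - 1)).
Proof.
move=> p1.
have p0 : 0 < p by rewrite (lt_trans ltr01).
have p10 : 0 < p - 1 by rewrite subr_gt0.
wlog ba : a b / b <= a => [hw a0 b0|a0 b0].
  by have [|/ltW] := leP b a => h; [|rewrite distrC (distrC a) (addrC a)]; apply: hw.
rewrite ger0_norm; last by rewrite subr_ge0 ge0_ler_powR ?nnegrE ?(ltW p0).
rewrite ger0_norm ?subr_ge0//.
(* Young's inequality expresses that the graph of t |-> t^p is above its tangent *)
have := @conjugate_powR R (a `^ (p - 1)) b (p / (p - 1)) p (powR_ge0 _ _) b0.
have q0 : 0 < p / (p - 1) by rewrite divr_gt0.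
move=> /(_ q0 p0); rewrite invf_div.
have -> : (p - 1) / p + p^-1 = 1 by field; rewrite gt_eqF.
move=> /(_ erefl); rewrite -powRrM.
have -> : (p - 1) * (p / (p - 1)) = p by field; rewrite gt_eqF.
rewrite -(mulr_powRB1 a0 p0) => h.
have {}h : p * (a `^ (p - 1) * b) <= (p - 1) * (a * a `^ (p - 1)) + b `^ p.
  have := ler_wpM2l (ltW p0) h.
  by congr (_ <= _); field; rewrite ?gt_eqF.
have h2 : p * ((a - b) * a `^ (p - 1)) <= p * ((a - b) * (a + b) `^ (p - 1)).
  rewrite ler_pM2l//; apply: ler_wpM2l; first by rewrite subr_ge0.
  by apply: ge0_ler_powR; rewrite ?(ltW p10) ?nnegrE ?addr_ge0 ?lerDl.
by apply: le_trans h2; move: h; set A := a `^ (p - 1); set B := b `^ p; nra.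
Qed.

(** Strong monotonicity of t |-> t^(p-1), for p >= 2. *)
Lemma powR_norm_le_mulB p a b : 2 <= p -> 0 <= a -> 0 <= b ->
  `|a - b| `^ p <= (a - b) * (a `^ (p - 1) - b `^ (p - 1)).
Proof.
move=> p2.
have p0 : 0 < p by rewrite (lt_le_trans _ p2).
have p1 : 1 <= p - 1 by lra.
wlog ba : a b / b <= a => [hw a0 b0|a0 b0].
  have [|/ltW] := leP b a => h; first exact: hw.
  by rewrite distrC -mulrNN !opprB; apply: hw.
rewrite ger0_norm ?subr_ge0// -mulr_powRB1 ?subr_ge0//.
by apply: ler_wpM2l; rewrite ?subr_ge0//; exact: powR_superadditive.
Qed.

Lemma powR_conj_normB_le p a b : 1 < p -> 0 <= a -> 0 <= b ->
  `|a `^ (p - 1) - b `^ (p - 1)| `^ (p / (p - 1)) <= `|a `^ p - b `^ p|.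
Proof.
move=> p1.
have p10 : 0 < p - 1 by rewrite subr_gt0.
wlog ba : a b / b <= a => [hw a0 b0|a0 b0].
  by have [|/ltW] := leP b a => h; [|rewrite distrC (distrC (a `^ p))]; apply: hw.
have pq : (p - 1) * (p / (p - 1)) = p by field; rewrite gt_eqF.
have h : b `^ (p - 1) <= a `^ (p - 1).
  by apply: ge0_ler_powR; rewrite ?nnegrE ?(ltW p10).
rewrite ger0_norm ?subr_ge0//.
apply: le_trans (powR_superadditive _ h _) _; first exact: powR_ge0.
  by rewrite ler_pdivlMr// mul1r gerBl.
by rewrite -!powRrM pq ler_norm.
Qed.

Lemma sqrB_le_norm_sqrB x y : 0 <= x -> 0 <= y ->
  (x - y) ^+ 2 <= `|x ^+ 2 - y ^+ 2|.
Proof.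
move=> x0 y0; rewrite subr_sqr normrM -real_normK ?num_real// expr2.
apply: ler_wpM2l => //; rewrite (ger0_norm (addr_ge0 x0 y0)).
by rewrite ler_norml; apply/andP; split; lra.
Qed.

Lemma mulB_le_norm_sqrB x y : 0 <= x -> 0 <= y ->
  `|y * (x - y)| <= `|x ^+ 2 - y ^+ 2|.
Proof.
move=> x0 y0; rewrite subr_sqr !normrM mulrC; apply: ler_wpM2l => //.
by rewrite !ger0_norm ?addr_ge0// lerDr.
Qed.

End power_inequalities.

(** * Weak derivatives *)

Section weak_partial.
Context {R : realType} {N : nat}.
Variable Omega : set 'rV[R]_N.
Local Notation mu := (@lebesgue_rV R N).
Hypotheses (oO : open Omega) (muO : (mu Omega < +oo)%E).
Implicit Types (f g u v w phi : 'rV[R]_N -> R) (i : 'I_N).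

Let mO : measurable Omega := measurable_open_rV oO.

Lemma compact_support_bounded f (K : set 'rV[R]_N) : continuous f ->
  compact K -> (forall x, ~ K x -> f x = 0) -> exists M, forall x, `|f x| <= M.
Proof.
move=> cf cK f0.
have /compact_bounded[M [_ /(_ (M + 1))]] : compact (f @` K).
  by apply: continuous_compact => //; exact: continuous_subspaceT.
rewrite ltrDl ltr01 => /(_ isT) KM.
exists (Num.max 0 (M + 1)) => x; have [Kx|/f0 ->] := pselect (K x).
  by rewrite le_max KM ?orbT//; exists x.
by rewrite normr0 le_max lexx.
Qed.

Lemma partial_compact_support i phi (K : set 'rV[R]_N) : compact K ->
  (forall x, ~ K x -> phi x = 0) -> forall x, ~ K x -> partial i phi x = 0.
Proof.
move=> cK phi0 x nKx; rewrite /partial.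
have <- : 'D_(delta_mx 0 i) (cst (0 : R)) x = 0 by exact: derive_cst.
apply: near_eq_derive.
have oK : open (~` K).
  by apply: closed_openC; apply: compact_closed => //; exact: norm_hausdorff.
near=> y; rewrite phi0//; near: y.
exact: open_nbhs_nbhs.
Unshelve. all: by end_near. Qed.

Lemma test_function_continuous phi : test_function Omega phi -> continuous phi.
Proof. by move=> [dphi _] x; apply: differentiable_continuous; exact: (dphi [::]). Qed.

Lemma test_partial_continuous i phi : test_function Omega phi ->
  continuous (partial i phi).
Proof.
by move=> [dphi _] x; apply: differentiable_continuous; exact: (dphi [:: i]).
Qed.

Lemma test_function_bounded phi : test_function Omega phi ->
  exists M, forall x, `|phi x| <= M.
Proof.
move=> tphi; have [_ [K [cK _ phi0]]] := tphi.
exact: compact_support_bounded (test_function_continuous tphi) cK phi0.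
Qed.

Lemma test_partial_bounded i phi : test_function Omega phi ->
  exists M, forall x, `|partial i phi x| <= M.
Proof.
move=> tphi; have [_ [K [cK _ phi0]]] := tphi.
apply: (compact_support_bounded _ cK); first exact: test_partial_continuous.
exact: partial_compact_support cK phi0.
Qed.

Lemma in_L2_integrable f : in_Lp Omega 2 f -> mu.-integrable Omega (EFin \o f).
Proof.
move=> f2; have l12 : 1 <= 2 :> R by lra.
have fi := inLp_integrable mO l12 f2.
have mf := inLp_measurable mO l12 f2.
apply: (@ae_le_integrable _ _ _ _ _ mO _ (fun x => 1 + `|f x| `^ 2)) => //.
  apply: RintegrableD => //.
  apply/integrableP; split; first exact: measurable_cst.
  rewrite /= (eq_integral (cst 1%E)); last by move=> x _; rewrite normr1.
  by rewrite integral_cst// mul1e.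
apply: aeW => x _; rewrite powR_mulrn//.
have := sqr_ge0 (`|f x| - 1); nra.
Qed.

Lemma integrable_mul_bounded f g (M : R) : mu.-integrable Omega (EFin \o f) ->
  measurable_fun Omega g -> (forall x, `|g x| <= M) ->
  mu.-integrable Omega (EFin \o (fun x => f x * g x)).
Proof.
move=> fi mg gM; have mf := Rintegrable_measurable fi.
apply: (@ae_le_integrable _ _ _ _ _ mO _ (fun x => M * `|f x|)).
- exact: measurable_funM.
- by apply: RintegrableZ => //; exact: Rintegrable_abs.
- by apply: aeW => x _; rewrite normrM mulrC; exact: ler_wpM2r.
Qed.

Lemma integrable_mul_test f phi : mu.-integrable Omega (EFin \o f) ->
  test_function Omega phi -> mu.-integrable Omega (EFin \o (fun x => f x * phi x)).
Proof.
move=> fi tphi; have [M phiM] := test_function_bounded tphi.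
apply: (integrable_mul_bounded fi _ phiM).
have mphi := measurable_continuous_rV (test_function_continuous tphi).
exact: measurable_funS mphi.
Qed.

Lemma integrable_mul_test_partial i f phi : mu.-integrable Omega (EFin \o f) ->
  test_function Omega phi ->
  mu.-integrable Omega (EFin \o (fun x => f x * partial i phi x)).
Proof.
move=> fi tphi; have [M phiM] := test_partial_bounded i tphi.
apply: (integrable_mul_bounded fi _ phiM).
have mphi := measurable_continuous_rV (@test_partial_continuous i _ tphi).
exact: measurable_funS mphi.
Qed.

Lemma is_weak_partialB i u w g h : in_Lp Omega 2 u -> in_Lp Omega 2 w ->
  is_weak_partial Omega i u g -> is_weak_partial Omega i w h ->
  is_weak_partial Omega i (u \- w) (g \- h).
Proof.
move=> u2 w2 [g2 gP] [h2 hP]; split.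
  by apply: (inLpB _ g2 h2); lra.
move=> phi tphi.
have /in_L2_integrable ui := u2; have /in_L2_integrable wi := w2.
have /in_L2_integrable gi := g2; have /in_L2_integrable hi := h2.
transitivity (\int[mu]_(x in Omega) (u x * partial i phi x) -
    \int[mu]_(x in Omega) (w x * partial i phi x)).
  rewrite -RintegralB//; try exact: integrable_mul_test_partial.
  by apply: eq_Rintegral => x _; rewrite mulrBl.
rewrite gP// hP// -opprD; congr (- _); rewrite -RintegralB//;
  try exact: integrable_mul_test.
by apply: eq_Rintegral => x _; rewrite mulrBl.
Qed.

Lemma is_weak_partial_unique i u g h :
  is_weak_partial Omega i u g -> is_weak_partial Omega i u h ->
  \forall x \ae mu, Omega x -> g x = h x.
Proof.
move=> [g2 gP] [h2 hP].
have /in_L2_integrable gi := g2; have /in_L2_integrable hi := h2.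
have := ae_eq0_test_function oO (RintegrableB mO gi hi).
have gh0 : forall phi, test_function Omega phi ->
    \int[mu]_(x in Omega) ((g x - h x) * phi x) = 0.
  move=> phi tphi.
  transitivity (\int[mu]_(x in Omega) (g x * phi x) -
      \int[mu]_(x in Omega) (h x * phi x)).
    rewrite -RintegralB//; try exact: integrable_mul_test.
    by apply: eq_Rintegral => x _; rewrite mulrBl.
  by apply/eqP; rewrite subr_eq0 -eqr_opp -gP// -hP.
move=> /(_ gh0); apply: filterS => x gh Ox.
by apply/eqP; rewrite -subr_eq0 gh.
Qed.

Lemma weak_partialP i u : W12 Omega u ->
  is_weak_partial Omega i u (weak_partial Omega i u).
Proof. by move=> [_ /(_ i)]; exact: xgetPex. Qed.

Lemma weak_partialB i u w : W12 Omega u -> W12 Omega w ->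
  \forall x \ae mu, Omega x ->
    weak_partial Omega i (u \- w) x = weak_partial Omega i u x - weak_partial Omega i w x.
Proof.
move=> uW wW; have [u2 _] := uW; have [w2 _] := wW.
have uwP := is_weak_partialB u2 w2 (weak_partialP i uW) (weak_partialP i wW).
apply: (is_weak_partial_unique _ uwP).
by apply: xgetPex; eexists; exact: uwP.
Qed.

Lemma integrable_mul_L2 f g : in_Lp Omega 2 f -> in_Lp Omega 2 g ->
  mu.-integrable Omega (EFin \o (fun x => f x * g x)).
Proof.
move=> f2 g2; apply: (hoelder_integrable mO _ _ _ f2 g2); lra.
Qed.

Lemma integrable_grad_dot u v : W12 Omega u -> W12 Omega v ->
  mu.-integrable Omega (EFin \o grad_dot Omega u v).
Proof.
move=> uW vW.
have := @integrable_sum _ _ _ mu Omega mO 'I_N (index_enum 'I_N) xpredT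
  (fun i x => (weak_partial Omega i u x * weak_partial Omega i v x)%:E).
move=> H; apply: eq_integrable (H _) => //.
  by move=> x _ /=; rewrite /grad_dot sumEFin.
move=> i _; apply: integrable_mul_L2.
  by have [] := weak_partialP i uW.
by have [] := weak_partialP i vW.
Qed.

Lemma Rintegral_grad_dotB u w : W12 Omega u -> W12 Omega w ->
  \int[mu]_(x in Omega) grad_dot Omega (u \- w) (u \- w) x =
  \int[mu]_(x in Omega) grad_dot Omega u u x -
  \int[mu]_(x in Omega) grad_dot Omega u w x -
  \int[mu]_(x in Omega) grad_dot Omega w u x +
  \int[mu]_(x in Omega) grad_dot Omega w w x.
Proof.
move=> uW wW.
have uui := integrable_grad_dot uW uW; have uwi := integrable_grad_dot uW wW.
have wui := integrable_grad_dot wW uW; have wwi := integrable_grad_dot wW wW.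
rewrite -RintegralB// -RintegralB//; last exact: RintegrableB.
rewrite -RintegralD//; last by apply: RintegrableB => //; exact: RintegrableB.
have uwW : W12 Omega (u \- w).
  have [u2 _] := uW; have [w2 _] := wW; split; first by apply: (inLpB _ u2 w2); lra.
  move=> i; eexists.
  exact: is_weak_partialB u2 w2 (weak_partialP i uW) (weak_partialP i wW).
apply: ae_eq_Rintegral => //.
- by apply: Rintegrable_measurable; exact: integrable_grad_dot.
- apply: (@Rintegrable_measurable _ _ _ mu); apply: RintegrableD => //.
  by apply: RintegrableB => //; exact: RintegrableB.
have : \forall x \ae mu, forall i, Omega x ->
    weak_partial Omega i (u \- w) x = weak_partial Omega i u x - weak_partial Omega i w x.
  apply: filter_forall => i.
  exact: weak_partialB.
apply: filterS => x E Ox; rewrite /grad_dot -!sumrB -big_split/=.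
by apply: eq_bigr => i _; rewrite E//; ring.
Qed.

End weak_partial.

(** * The Rayleigh quotient is bounded below *)

Section bounded_below.
Context {R : realType} {N : nat}.
Variables (Omega : set 'rV[R]_N) (p : R).
Local Notation mu := (@lebesgue_rV R N).
Hypotheses (oO : open Omega) (muO : (mu Omega < +oo)%E) (p2 : 2 <= p).
Implicit Types (q u v w phi : 'rV[R]_N -> R) (c : R).

Let mO : measurable Omega := measurable_open_rV oO.
Let p1 : 1 <= p. Proof. by apply: le_trans p2; rewrite ler1n. Qed.
Let p_gt0 : 0 < p. Proof. exact: lt_le_trans p1. Qed.
Let p0 : p != 0. Proof. by rewrite gt_eqF. Qed.

Lemma inLp_cst c : inLp mu Omega p (cst c).
Proof.
apply/inLpP => //; split; first exact: measurable_cst.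
change (mu.-integrable Omega (EFin \o cst (`|c| `^ p))).
apply/integrableP; split.
  by apply/measurable_EFinP; exact: measurable_cst.
rewrite /= (eq_integral (cst (`|c| `^ p)%:E)).
  by rewrite integral_cst// lte_mul_pinfty// lee_fin powR_ge0.
by move=> x _; rewrite ger0_norm ?powR_ge0.
Qed.

Lemma Lp_distE u v : Lp_dist Omega p u v = nrm mu Omega p (fun x => u x - v x).
Proof. by rewrite -fine_LnormE. Qed.

(** The values whose infimum is [lambda1 Omega q]. *)
Definition rayleigh_set q : set R := [set rayleigh Omega q phi | phi in
  [set phi | W012 Omega phi /\ ~ (phi = cst 0 %[ae mu in Omega])]].

Lemma W012_L2 phi : W012 Omega phi -> in_Lp Omega 2 phi.
Proof. by move=> [[]]. Qed.

Lemma integrable_sqr phi : in_Lp Omega 2 phi ->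
  mu.-integrable Omega (EFin \o (fun x => phi x ^+ 2)).
Proof.
by move=> phi2; apply: eq_integrable (integrable_mul_L2 oO phi2 phi2).
Qed.

Lemma Rintegral_sqr_gt0 phi : in_Lp Omega 2 phi ->
  ~ (phi = cst 0 %[ae mu in Omega]) -> 0 < \int[mu]_(x in Omega) (phi x ^+ 2).
Proof.
move=> phi2 nphi; rewrite lt0r; apply/andP; split; last first.
  by apply: Rintegral_ge0 => x _; exact: sqr_ge0.
apply/eqP => phi0; apply: nphi.
have := Rintegral_abs_eq0 mO (integrable_sqr phi2).
have -> : \int[mu]_(x in Omega) `|phi x ^+ 2| = 0.
  by rewrite -phi0; apply: eq_Rintegral => x _; rewrite ger0_norm// sqr_ge0.
move=> /(_ erefl); apply: filterS => x /[apply] /eqP.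
by rewrite sqrf_eq0 => /eqP.
Qed.

Lemma Rintegral_grad_ge0 phi : 0 <= \int[mu]_(x in Omega) grad_dot Omega phi phi x.
Proof.
by apply: Rintegral_ge0 => x _; apply: sumr_ge0 => i _; rewrite -expr2 sqr_ge0.
Qed.

Lemma rayleigh_cst c phi : in_Lp Omega 2 phi ->
  ~ (phi = cst 0 %[ae mu in Omega]) ->
  rayleigh Omega (cst c) phi =
  (\int[mu]_(x in Omega) grad_dot Omega phi phi x) /
    (\int[mu]_(x in Omega) (phi x ^+ 2)) + c.
Proof.
move=> phi2 /(Rintegral_sqr_gt0 phi2) phi0; rewrite /rayleigh RintegralZl//.
  by rewrite mulrDl mulfK// gt_eqF.
exact: integrable_sqr.
Qed.

(** The existence of a nonzero [phi] ensures that the infimum defining [lambda1]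
    is not over the empty set. *)
Lemma lambda1_cst_lt0 phi : W012 Omega phi ->
  ~ (phi = cst 0 %[ae mu in Omega]) -> exists c, lambda1 Omega (cst c) < 0.
Proof.
move=> phiW nphi.
pose G := (\int[mu]_(x in Omega) grad_dot Omega phi phi x) /
    (\int[mu]_(x in Omega) (phi x ^+ 2)).
exists (- (G + 1)).
have : lambda1 Omega (cst (- (G + 1))) <=
    rayleigh Omega (cst (- (G + 1))) phi.
  apply: ge_inf; last by exists phi.
  exists (- (G + 1)) => _ [psi [psiW npsi] <-].
  rewrite rayleigh_cst//; last exact: W012_L2.
  rewrite lerDr divr_ge0 ?Rintegral_grad_ge0// ltW// Rintegral_sqr_gt0//.
  exact: W012_L2.
rewrite rayleigh_cst//; last exact: W012_L2.
by rewrite -/G => h; apply: le_lt_trans h _; lra.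
Qed.

(** The part of [q] exceeding the level [k] in absolute value. *)
Definition excess (k : nat) q : 'rV[R]_N -> R :=
  fun x => q x - Num.max (- k%:R) (Num.min (q x) k%:R).

Lemma excess_le k q x : `|excess k q x| <= `|q x|.
Proof.
rewrite /excess; have k0 : 0 <= k%:R :> R by [].
case: (leP (q x) k%:R) => h1; case: (leP (- k%:R) _) => h2; rewrite ?subrr ?normr0//.
- by rewrite ler_norml; apply/andP; split; have := ler_norm (- q x); rewrite normrN; lra.
- by rewrite ler_norml; apply/andP; split; have := ler_norm (q x); lra.
- by rewrite ler_norml; apply/andP; split; have := ler_norm (q x); lra.
Qed.

Lemma subr_excess_le k q x : `|q x - excess k q x| <= k%:R.
Proof.
rewrite /excess subKr; have k0 : 0 <= k%:R :> R by [].
rewrite ler_norml le_max lexx/= ge_max; apply/andP; split; first by lra.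
by rewrite ge_min lexx orbT.
Qed.

Lemma excess_eq0 k q x : `|q x| <= k%:R -> excess k q x = 0.
Proof.
by rewrite ler_norml /excess => /andP[h1 h2]; rewrite min_l// max_r// subrr.
Qed.

Lemma inLp_excess k q : inLp mu Omega p q -> inLp mu Omega p (excess k q).
Proof.
move=> qp; have mq := inLp_measurable mO p1 qp.
apply: (ae_le_inLp mO p1 _ qp); last by apply: aeW => x _; exact: excess_le.
apply: measurable_funB => //; apply: measurable_maxr => //.
exact: measurable_minr.
Qed.

Lemma nrm_excess_small q (e : R) : inLp mu Omega p q -> 0 < e ->
  exists k, nrm mu Omega p (excess k q) < e.
Proof.
move=> qp e0.
have := @dominated_convergence _ _ _ mu Omega mO
  (fun k x => (`|excess k q x| `^ p)%:E) (cst 0%E) (fun x => (`|q x| `^ p)%:E).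
case.
- move=> k; apply/measurable_EFinP.
  by have /Rintegrable_measurable := inLp_integrable mO p1 (inLp_excess k qp).
- exact: measurable_cst.
- apply: aeW => x _; apply: cvg_near_cst; near=> k.
  rewrite excess_eq0 ?normr0 ?powR0//=.
  near: k; exact: nbhs_infty_ger.
- exact: inLp_integrable.
- apply: aeW => x k _ /=; rewrite lee_fin ger0_norm ?powR_ge0//.
  by apply: ge0_ler_powR; rewrite ?nnegrE ?excess_le ?(ltW p_gt0).
move=> _ _; rewrite integral0 => /fine_cvg /cvgr0Pnorm_lt.
move=> /(_ _ (powR_gt0 p e0)) [k _ /(_ k (leqnn k))] /= h.
exists k; apply: nrm_lt => //.
by apply: le_lt_trans h; exact: ler_norm.
Unshelve. all: by end_near. Qed.

(** If [q * phi^2] were not integrable, its integral would be 0 and the Rayleigh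
    quotient of [q] nonnegative. *)
Lemma rayleigh_shift_le c k q phi : W012 Omega phi ->
  ~ (phi = cst 0 %[ae mu in Omega]) -> inLp mu Omega p q ->
  rayleigh Omega q phi < 0 ->
  rayleigh Omega (fun x => c + excess k q x) phi <=
  rayleigh Omega q phi + (`|c| + k%:R).
Proof.
move=> phiW nphi qp; have phi2 := W012_L2 phiW.
have I0 := Rintegral_sqr_gt0 phi2 nphi.
have mq := inLp_measurable mO p1 qp.
have phi_i := integrable_sqr phi2.
have mphi := Rintegrable_measurable phi_i.
rewrite /rayleigh ltr_pdivrMr// mul0r => h.
have qphi0 : \int[mu]_(x in Omega) (q x * phi x ^+ 2) != 0.
  by rewrite lt_eqF// (le_lt_trans _ h)// lerDr Rintegral_grad_ge0.
have qphi_i := Rintegral_neq0_integrable mO (measurable_funM mq mphi) qphi0.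
have In0 : \int[mu]_(x in Omega) (phi x ^+ 2) != 0 by rewrite gt_eqF.
rewrite -[`|c| + k%:R](mulfK In0) -mulrDl.
rewrite ler_pM2r ?invr_gt0// -addrA lerD2l.
rewrite -RintegralZl// -RintegralD//; last exact: RintegrableZ.
have mex := inLp_measurable mO p1 (inLp_excess k qp).
have di : mu.-integrable Omega
    (EFin \o (fun x => (c + (excess k q x - q x)) * phi x ^+ 2)).
  apply: (ae_le_integrable mO _ (RintegrableZ mO (`|c| + k%:R) phi_i)).
    apply: measurable_funM => //; apply: measurable_funD => //.
    exact: measurable_funB.
  apply: aeW => x _; rewrite normrM (ger0_norm (sqr_ge0 _)).
  apply: ler_wpM2r; first exact: sqr_ge0.
  apply: le_trans (ler_normD _ _) _; rewrite lerD2l distrC.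
  exact: subr_excess_le.
apply: (@ae_le_Rintegral _ _ _ _ _ mO).
- apply: eq_integrable (RintegrableD mO qphi_i di) => // x _ /=.
  by congr EFin; ring.
- by apply: RintegrableD => //; exact: RintegrableZ.
- apply: aeW => x _; rewrite -subr_ge0.
  have -> : q x * phi x ^+ 2 + (`|c| + k%:R) * phi x ^+ 2 -
    (c + excess k q x) * phi x ^+ 2 =
    (`|c| - c + (k%:R + (q x - excess k q x))) * phi x ^+ 2 by ring.
  apply: mulr_ge0; last exact: sqr_ge0.
  have := subr_excess_le k q x; rewrite ler_norml => /andP[h1 h2].
  by have := ler_norm c; lra.
Qed.

(** Suppose that the Rayleigh quotients of [q] are unbounded below. The infimum
    of an unbounded set being 0 by convention, [lambda1] is 0 at [q], and also at
    the potentials obtained by adding to a constant [c] the part of [q] above a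
    high level, since only a bounded part of [q] is left out. These potentials
    tend to [c] in L^p, so a potential at minimal distance from [c] among those
    with [lambda1] equal to 0 is [c] itself, which is absurd when [c] is so
    negative that [lambda1 c < 0]. *)
Lemma rayleigh_has_lbound q :
  (forall lambda q0, in_Lp Omega p q0 -> lambda1 Omega q0 < lambda ->
    exists qh, is_qhat Omega p lambda q0 qh) ->
  in_Lp Omega p q -> has_lbound (rayleigh_set q).
Proof.
move=> qhatP qp; apply: contrapT => unb.
have [phi [phiW nphi]] : exists phi, W012 Omega phi /\
    ~ (phi = cst 0 %[ae mu in Omega]).
  apply: contrapT => none; apply: unb; exists 0 => y [phi phiP _].
  by exfalso; apply: none; exists phi.
have [c c0] := lambda1_cst_lt0 phiW nphi.
have [qh [qhp lambda_qh dist_qh]] := qhatP 0 _ (inLp_cst c) c0.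
pose r k := fun x => c + excess k q x.
have rp k : in_Lp Omega p (r k).
  by apply: (inLpD (f := cst c)) => //; [exact: inLp_cst|exact: inLp_excess].
have lambda_r k : lambda1 Omega (r k) = 0.
  apply: inf_out => -[_ [m mP]]; apply: unb.
  exists (Num.min 0 (m - (`|c| + k%:R))) => _ [psi [psiW npsi] <-].
  have [h|h] := leP 0 (rayleigh Omega q psi); first by rewrite ge_min h.
  rewrite ge_min lerBlDr; apply/orP; right.
  apply: le_trans (rayleigh_shift_le c k psiW npsi qp h).
  by apply: mP; exists psi.
have dist0 : Lp_dist Omega p (cst c) qh = 0.
  apply/eqP; rewrite eq_le Lp_distE nrm_ge0 andbT.
  apply/ler_addgt0Pl => e e0; rewrite addr0 -Lp_distE dist_qh.
  have [k ke] := nrm_excess_small qp e0.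
  have : Lp_dist Omega p (cst c) (r k) < e.
    rewrite Lp_distE nrm_normB (@eq_nrm _ _ _ _ _ _ _ (excess k q))// => x _.
    by rewrite /r /= addrC addKr.
  move=> /ltW; apply: le_trans; apply: ge_inf; last by exists (r k).
  by exists 0 => _ [s _ <-]; rewrite Lp_distE nrm_ge0.
have qhE : \forall x \ae mu, Omega x -> qh x = c.
  have di := inLp_integrable mO p1 (inLpB p1 (inLp_cst c) qhp).
  have := Rintegral_abs_eq0 mO di.
  have -> : \int[mu]_(x in Omega) `|(`|cst c x - qh x| `^ p)| = 0.
    transitivity (\int[mu]_(x in Omega) (`|cst c x - qh x| `^ p)).
      by apply: eq_Rintegral => x _; rewrite ger0_norm ?powR_ge0.
    by rewrite -nrmK// -Lp_distE dist0 powR0.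
  move=> /(_ erefl); apply: filterS => x /[apply] /powR_eq0_eq0.
  by move=> /normr0_eq0/eqP; rewrite subr_eq0 => /eqP.
have rE phi' : W012 Omega phi' ->
    rayleigh Omega qh phi' = rayleigh Omega (cst c) phi'.
  move=> phiW'; rewrite /rayleigh; congr ((_ + _) / _).
  have mphi' := Rintegrable_measurable (integrable_sqr (W012_L2 phiW')).
  apply: ae_eq_Rintegral => //.
  - by apply: measurable_funM => //; exact: inLp_measurable qhp.
  - exact: measurable_funM.
  - by apply: filterS qhE => x h Ox; rewrite h.
have : lambda1 Omega qh = lambda1 Omega (cst c).
  congr inf; apply/seteqP; split => _ [phi' [phiW' nphi'] <-]; exists phi' => //.
    by rewrite rE.
  by rewrite rE.
by rewrite -lambda_qh => h; move: c0; rewrite -h ltxx.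
Qed.

End bounded_below.

(** * Stability of the optimal potentials and of the positive solutions *)

Lemma admissible_exponent_ge2 (R : realType) (N : nat) (p : R) :
  admissible_exponent N p -> 2 <= p.
Proof.
case=> [[_ //]|[_ /ltW//]|[N4]]; apply: le_trans.
rewrite ler_pdivlMr// -natrM ler_nat.
exact: ltnW.
Qed.

Section stability.
Context {R : realType} {N : nat}.
Variables (Omega : set 'rV[R]_N) (p : R).
Local Notation mu := (@lebesgue_rV R N).
Hypotheses (oO : open Omega) (muO : (mu Omega < +oo)%E) (p2 : 2 <= p).
Hypothesis rayleighP : forall q : 'rV[R]_N -> R, in_Lp Omega p q ->
  has_lbound (rayleigh_set Omega q).
Implicit Types (q u v w phi : 'rV[R]_N -> R) (c lambda : R).

Let mO : measurable Omega := measurable_open_rV oO.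
Let p1 : 1 <= p. Proof. by apply: le_trans p2; rewrite ler1n. Qed.
Let p_gt1 : 1 < p. Proof. by apply: lt_le_trans p2; rewrite ltr1n. Qed.
Let p_gt0 : 0 < p. Proof. exact: lt_le_trans p1. Qed.
Let p0 : p != 0. Proof. by rewrite gt_eqF. Qed.
Let pB1 : 0 < p - 1. Proof. by rewrite subr_gt0. Qed.

(** The exponent conjugate to [p]. *)
Let p' := p / (p - 1).
Let p'1 : 1 <= p'. Proof. by rewrite ler_pdivlMr// mul1r gerBl. Qed.
Let p'0 : p' != 0. Proof. by rewrite gt_eqF// (lt_le_trans _ p'1). Qed.
Let pp' : p^-1 + p'^-1 = 1.
Proof. by rewrite /p'; field; rewrite p0 gt_eqF. Qed.

Local Notation normp := (nrm mu Omega p).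
Local Notation normp' := (nrm mu Omega p').
Local Notation "'Grad' u v" := (\int[mu]_(x in Omega) grad_dot Omega u v x)
  (at level 10, u at level 8, v at level 8).

(** [q] is the optimal potential for [lambda] and [q0], and [u] the
    corresponding positive solution. *)
Definition optimal_pair lambda q0 q u : Prop :=
  [/\ in_Lp Omega p q0, is_qhat Omega p lambda q0 q &
      is_uhat Omega p lambda q0 q u].

Section one_pair.
Variables (lambda : R) (q0 q u : 'rV[R]_N -> R).
Hypothesis qu : optimal_pair lambda q0 q u.

Lemma optimal_in_Lp : inLp mu Omega p q.
Proof. by have [_ []] := qu. Qed.

Lemma optimal_in_Lp0 : inLp mu Omega p q0.
Proof. by have [] := qu. Qed.

Lemma optimal_excess_in_Lp : inLp mu Omega p (fun x => q x - q0 x).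
Proof. exact: (inLpB p1 optimal_in_Lp optimal_in_Lp0). Qed.

Lemma optimal_W012 : W012 Omega u.
Proof. by have [_ _ [[]]] := qu. Qed.

Lemma optimal_ae : \forall x \ae mu, Omega x ->
  [/\ 0 < u x, 0 <= q x - q0 x, u x ^+ 2 = (q x - q0 x) `^ (p - 1) &
      u x `^ ((p + 1) / (p - 1)) = (q x - q0 x) * u x].
Proof.
have [_ _ [[_ u0 _] uE]] := qu.
apply: filterS2 u0 uE => x u0 uE Ox; have {}u0 := u0 Ox; have {}uE := uE Ox.
have -> : q x - q0 x = u x `^ (2 / (p - 1)) by rewrite uE addrC addKr.
split=> //; first exact: powR_ge0.
  by rewrite -powRrM divfK ?gt_eqF// powR_mulrn// ltW.
have -> : (p + 1) / (p - 1) = 2 / (p - 1) + 1 by field; rewrite gt_eqF.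
by rewrite powRD ?powRr1 ?(ltW u0)//; apply/implyP => _; rewrite gt_eqF.
Qed.

Lemma optimal_measurable : measurable_fun Omega u.
Proof.
have u2 := W012_L2 optimal_W012.
by apply: (inLp_measurable mO _ u2); rewrite ler1n.
Qed.

Lemma optimal_sqr_powR : \forall x \ae mu, Omega x ->
  `|u x ^+ 2| `^ p' = `|q x - q0 x| `^ p.
Proof.
apply: filterS optimal_ae => x h Ox; have [_ a0 -> _] := h Ox.
rewrite ger0_norm ?powR_ge0// ger0_norm// -powRrM.
by congr (_ `^ _); rewrite /p'; field; rewrite gt_eqF.
Qed.

Lemma optimal_sqr_in_Lp' : inLp mu Omega p' (fun x => u x ^+ 2).
Proof.
have mu2 : measurable_fun Omega (fun x => u x ^+ 2).
  exact: measurable_funX optimal_measurable.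
apply/inLpP => //; split => //.
apply: (ae_le_integrable mO _ (inLp_integrable mO p1 optimal_excess_in_Lp)).
  by apply: (measurableT_comp (measurable_powR _)); exact: measurableT_comp.
apply: filterS optimal_sqr_powR => x h Ox.
by rewrite ger0_norm ?powR_ge0// h.
Qed.

Lemma nrm_optimal_sqr :
  normp' (fun x => u x ^+ 2) = normp (fun x => q x - q0 x) `^ (p - 1).
Proof.
have -> : p - 1 = p / p' by rewrite /p'; field; rewrite p0 gt_eqF.
apply: nrm_powR; last exact: p0.
apply: (ae_eq_Rintegral mO).
- exact: Rintegrable_measurable (inLp_integrable mO p'1 optimal_sqr_in_Lp').
- exact: Rintegrable_measurable (inLp_integrable mO p1 optimal_excess_in_Lp).
- exact: optimal_sqr_powR.
Qed.

(** Products of two solutions pair with potentials. *)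
Lemma mul_in_Lp' v w : measurable_fun Omega v -> measurable_fun Omega w ->
  inLp mu Omega p' (fun x => v x ^+ 2) -> inLp mu Omega p' (fun x => w x ^+ 2) ->
  inLp mu Omega p' (fun x => v x * w x).
Proof.
move=> mv mw vp wp.
apply: (ae_le_inLp mO p'1 _ (inLpD p'1 vp wp)); first exact: measurable_funM.
apply: aeW => x _; rewrite [leRHS]ger0_norm ?addr_ge0 ?sqr_ge0//.
by rewrite ler_norml; apply/andP; split; nra.
Qed.

Lemma shift_in_Lp c r : inLp mu Omega p r -> inLp mu Omega p (fun x => r x - c).
Proof. by move=> rp; apply: (inLpB p1 rp (inLp_cst oO muO p2 c)). Qed.

Lemma one_in_Lp : inLp mu Omega p (fun=> 1). Proof. exact: inLp_cst. Qed.

Lemma mul_in_L1 r v : inLp mu Omega p r -> inLp mu Omega p' v ->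
  mu.-integrable Omega (EFin \o (fun x => r x * v x)).
Proof. exact: hoelder_integrable. Qed.

Lemma in_Lp'_L1 v : inLp mu Omega p' v -> mu.-integrable Omega (EFin \o v).
Proof.
move=> vp; apply: eq_integrable (mul_in_L1 one_in_Lp vp) => //.
by move=> x _ /=; rewrite mul1r.
Qed.

(** The weak equation, with the nonlinear term absorbed by the optimal
    potential. *)
Lemma optimal_weak v : W012 Omega v -> inLp mu Omega p' (fun x => v x ^+ 2) ->
  Grad u v = - \int[mu]_(x in Omega) ((q x - lambda) * (u x * v x)).
Proof.
move=> vW v2p; have [_ _ [[_ _ /(_ _ vW) uvE] _]] := qu.
have mv : measurable_fun Omega v.
  by apply: (inLp_measurable mO _ (W012_L2 vW)); rewrite ler1n.
have mu' := optimal_measurable.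
have uvp := mul_in_Lp' mu' mv optimal_sqr_in_Lp' v2p.
have uv1 := in_Lp'_L1 uvp.
have q0uv1 := mul_in_L1 optimal_in_Lp0 uvp.
have auv1 := mul_in_L1 optimal_excess_in_Lp uvp.
have E1 : \int[mu]_(x in Omega) (q0 x * u x * v x) =
    \int[mu]_(x in Omega) (q0 x * (u x * v x)).
  by apply: eq_Rintegral => x _; rewrite mulrA.
have E2 : \int[mu]_(x in Omega) (u x `^ ((p + 1) / (p - 1)) * v x) =
    \int[mu]_(x in Omega) ((q x - q0 x) * (u x * v x)).
  apply: (ae_eq_Rintegral mO).
  - apply: measurable_funM => //.
    exact: (measurableT_comp (measurable_powR _)).
  - exact: Rintegrable_measurable auv1.
  - apply: filterS optimal_ae => x h Ox; have [_ _ _ ->] := h Ox.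
    by rewrite mulrA.
have E3 : \int[mu]_(x in Omega) ((q x - lambda) * (u x * v x)) =
    \int[mu]_(x in Omega) (q0 x * (u x * v x)) +
    \int[mu]_(x in Omega) ((q x - q0 x) * (u x * v x)) -
    lambda * \int[mu]_(x in Omega) (u x * v x).
  rewrite -RintegralD// -RintegralZl// -RintegralB//.
  - by apply: eq_Rintegral => x _; ring.
  - exact: RintegrableD.
  - exact: RintegrableZ.
by move: uvE; rewrite E1 E2 E3 => uvE; lra.
Qed.

End one_pair.

(** The variational inequality for the principal eigenvalue. *)
Lemma lambda1_le r w : in_Lp Omega p r -> W012 Omega w ->
  inLp mu Omega p' (fun x => w x ^+ 2) ->
  lambda1 Omega r * \int[mu]_(x in Omega) (w x ^+ 2) <=
  Grad w w + \int[mu]_(x in Omega) (r x * w x ^+ 2).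
Proof.
move=> rp wW w2p; have w2 := W012_L2 wW.
have [w0|nw0] := pselect (w = cst 0 %[ae mu in Omega]); last first.
  have I0 := Rintegral_sqr_gt0 oO w2 nw0.
  rewrite -ler_pdivlMr//; apply: ge_inf; first exact: rayleighP.
  by exists w.
have w1 := in_Lp'_L1 w2p; have rw1 := mul_in_L1 rp w2p.
have -> : \int[mu]_(x in Omega) (w x ^+ 2) = \int[mu]_(x in Omega) (0 : R).
  apply: (ae_eq_Rintegral mO); first exact: Rintegrable_measurable w1.
    exact: measurable_cst.
  by apply: filterS w0 => x h Ox; rewrite h// expr0n.
have -> : \int[mu]_(x in Omega) (r x * w x ^+ 2) = \int[mu]_(x in Omega) (0 : R).
  apply: (ae_eq_Rintegral mO); first exact: Rintegrable_measurable rw1.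
    exact: measurable_cst.
  by apply: filterS w0 => x h Ox; rewrite h// expr0n mulr0.
by rewrite Rintegral_cst// mul0r mulr0 addr0 Rintegral_grad_ge0.
Qed.

Lemma Rintegral_shift r c v : inLp mu Omega p r -> inLp mu Omega p' v ->
  \int[mu]_(x in Omega) ((r x - c) * v x) =
  \int[mu]_(x in Omega) (r x * v x) - c * \int[mu]_(x in Omega) v x.
Proof.
move=> rp vp; rewrite -RintegralZl//; last exact: in_Lp'_L1.
rewrite -RintegralB//.
- by apply: eq_Rintegral => x _; rewrite mulrBl.
- exact: mul_in_L1.
- by apply: RintegrableZ => //; exact: in_Lp'_L1.
Qed.

Section norm_bounds.
Variables (lambda : R) (q0 q u : 'rV[R]_N -> R).
Hypothesis qu : optimal_pair lambda q0 q u.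
Local Notation a := (fun x => q x - q0 x).

Let u2p := optimal_sqr_in_Lp' qu.
Let ap := optimal_excess_in_Lp qu.

Lemma optimal_energy :
  normp a `^ p = - (Grad u u + \int[mu]_(x in Omega) ((q0 x - lambda) * u x ^+ 2)).
Proof.
have := optimal_weak qu (optimal_W012 qu) u2p.
have -> : \int[mu]_(x in Omega) ((q x - lambda) * (u x * u x)) =
    \int[mu]_(x in Omega) ((q0 x - lambda) * u x ^+ 2) +
    \int[mu]_(x in Omega) ((q x - q0 x) * u x ^+ 2).
  rewrite -RintegralD//.
  - by apply: eq_Rintegral => x _; ring.
  - by apply: mul_in_L1 => //; apply: shift_in_Lp; exact: optimal_in_Lp0 qu.
  - exact: mul_in_L1.
have -> : \int[mu]_(x in Omega) ((q x - q0 x) * u x ^+ 2) = normp a `^ p.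
  rewrite nrmK//; apply: (ae_eq_Rintegral mO).
  - exact: Rintegrable_measurable (mul_in_L1 ap u2p).
  - exact: Rintegrable_measurable (inLp_integrable mO p1 ap).
  - apply: filterS (optimal_ae qu) => x h Ox; have [_ a0 -> _] := h Ox.
    by rewrite mulr_powRB1// ger0_norm.
by move=> ->; ring.
Qed.

Lemma normp_le_of_powR (t : R) : normp a `^ p <= t * normp a `^ (p - 1) ->
  0 <= t -> normp a <= t.
Proof.
have := nrm_ge0 mu Omega p a; rewrite le_eqVlt => /predU1P[<-//|a0] h _.
by move: h; rewrite -mulr_powRB1 ?(ltW a0)// ler_pM2r// powR_gt0.
Qed.

Lemma normp_excess_le : normp a <= normp (fun x => q0 x - lambda).
Proof.
apply: normp_le_of_powR (nrm_ge0 _ _ _ _).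
rewrite optimal_energy -(nrm_optimal_sqr qu) opprD.
have Vp : inLp mu Omega p (fun x => q0 x - lambda).
  by apply: shift_in_Lp; exact: optimal_in_Lp0 qu.
apply: le_trans (hoelder_nrm mO p1 p'1 pp' Vp u2p).
have Vu := mul_in_L1 Vp u2p.
have := le_normr_Rintegral mO Vu; rewrite ler_norml => /andP[h _].
by have := Rintegral_grad_ge0 Omega u; lra.
Qed.

Lemma normp_excess_le_lambda1 : lambda1 Omega q0 <= lambda ->
  normp a <= (lambda - lambda1 Omega q0) * normp (cst 1).
Proof.
move=> ll; apply: normp_le_of_powR; last by rewrite mulr_ge0 ?nrm_ge0// subr_ge0.
rewrite optimal_energy Rintegral_shift//; last exact: optimal_in_Lp0 qu.
have := lambda1_le (optimal_in_Lp0 qu) (optimal_W012 qu) u2p.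
have : \int[mu]_(x in Omega) (u x ^+ 2) <= normp (cst 1) * normp a `^ (p - 1).
  rewrite -(nrm_optimal_sqr qu).
  apply: le_trans (hoelder_le mO p1 p'1 pp' one_in_Lp u2p).
  by rewrite le_eqVlt; apply/orP; left; apply/eqP/eq_Rintegral => x _; rewrite mul1r.
have ll0 : 0 <= lambda - lambda1 Omega q0 by rewrite subr_ge0.
move=> /(ler_wpM2l ll0); rewrite mulrA.
set I := \int[mu]_(x in Omega) (u x ^+ 2); move=> h1 h2.
by apply: le_trans h1; lra.
Qed.

End norm_bounds.

(** The variational inequality for [q], tested with the solution attached to
    [q']. *)
Lemma optimal_cross lambda lambda' q0 q u q0' q' u' :
  optimal_pair lambda q0 q u -> optimal_pair lambda' q0' q' u' ->
  0 <= \int[mu]_(x in Omega) (((q x - lambda) - (q' x - lambda')) * u' x ^+ 2).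
Proof.
move=> qu qu'; have u2p' := optimal_sqr_in_Lp' qu'.
have [_ [qp lambdaE _] _] := qu; have q'p := optimal_in_Lp qu'.
have := lambda1_le qp (optimal_W012 qu') u2p'.
rewrite -lambdaE (optimal_weak qu' (optimal_W012 qu') u2p').
have -> : \int[mu]_(x in Omega) ((q' x - lambda') * (u' x * u' x)) =
  \int[mu]_(x in Omega) ((q' x - lambda') * u' x ^+ 2).
  by apply: eq_Rintegral => x _; rewrite expr2.
have -> : \int[mu]_(x in Omega) (((q x - lambda) - (q' x - lambda')) * u' x ^+ 2)
   = \int[mu]_(x in Omega) ((q x - lambda) * u' x ^+ 2) -
     \int[mu]_(x in Omega) ((q' x - lambda') * u' x ^+ 2).
  rewrite -RintegralB//.
  - by apply: eq_Rintegral => x _; rewrite mulrBl.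
  - by apply: mul_in_L1 => //; exact: shift_in_Lp.
  - by apply: mul_in_L1 => //; exact: shift_in_Lp.
by rewrite (Rintegral_shift lambda qp u2p'); lra.
Qed.

Lemma powR_in_Lp' f : inLp mu Omega p f ->
  inLp mu Omega p' (fun x => `|f x| `^ (p - 1)).
Proof.
move=> fp; have mf := inLp_measurable mO p1 fp; apply/inLpP => //; split.
  by apply: (measurableT_comp (measurable_powR _)); exact: measurableT_comp.
apply: eq_integrable (inLp_integrable mO p1 fp) => // x _ /=.
rewrite [in RHS]ger0_norm ?powR_ge0// -powRrM; congr (_ `^ _)%:E.
by rewrite /p'; field; rewrite gt_eqF.
Qed.

Lemma nrm_powR_in_Lp' f :
  normp' (fun x => `|f x| `^ (p - 1)) = normp f `^ (p - 1).
Proof.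
have -> : normp f `^ (p - 1) = normp f `^ (p / p').
  by congr (_ `^ _); rewrite /p'; field; rewrite p0 gt_eqF.
apply: nrm_powR; last exact: p0.
apply: eq_Rintegral => x _.
rewrite ger0_norm ?powR_ge0// -powRrM; congr (_ `^ _).
by rewrite /p'; field; rewrite gt_eqF.
Qed.

Section two_pairs.
Variables (lambda lambda' : R) (q0 q u q0' q' u' : 'rV[R]_N -> R).
Hypotheses (qu : optimal_pair lambda q0 q u)
  (qu' : optimal_pair lambda' q0' q' u').
Local Notation a := (fun x => q x - q0 x).
Local Notation a' := (fun x => q' x - q0' x).
Local Notation du2 := (fun x => u x ^+ 2 - u' x ^+ 2).
Local Notation dV := (fun x => (q0 x - lambda) - (q0' x - lambda')).
Local Notation da := (fun x => (q x - q0 x) - (q' x - q0' x)).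

Let u2p := optimal_sqr_in_Lp' qu.
Let u2p' := optimal_sqr_in_Lp' qu'.
Let ap := optimal_excess_in_Lp qu.
Let ap' := optimal_excess_in_Lp qu'.
Let du2p : inLp mu Omega p' du2.
Proof. exact: (inLpB p'1 u2p u2p'). Qed.
Let dap : inLp mu Omega p da.
Proof. exact: (inLpB p1 ap ap'). Qed.
Let Vp : inLp mu Omega p (fun x => q0 x - lambda).
Proof. by apply: shift_in_Lp; exact: optimal_in_Lp0 qu. Qed.
Let Vp' : inLp mu Omega p (fun x => q0' x - lambda').
Proof. by apply: shift_in_Lp; exact: optimal_in_Lp0 qu'. Qed.
Let dVp : inLp mu Omega p dV.
Proof. exact: (inLpB p1 Vp Vp'). Qed.
Let Qp : inLp mu Omega p (fun x => q x - lambda).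
Proof. by apply: shift_in_Lp; exact: optimal_in_Lp qu. Qed.
Let Qp' : inLp mu Omega p (fun x => q' x - lambda').
Proof. by apply: shift_in_Lp; exact: optimal_in_Lp qu'. Qed.

(** Sum of the two cross inequalities. *)
Lemma normp_da_le : normp da `^ p <= normp dV * normp' du2.
Proof.
have := optimal_cross qu qu'.
have := optimal_cross qu' qu.
have dadu := mul_in_L1 dap du2p; have dVdu := mul_in_L1 dVp du2p.
move=> h1 h2.
have {h1 h2} : \int[mu]_(x in Omega) (da x * du2 x) <=
    \int[mu]_(x in Omega) `|dV x * du2 x|.
  have := le_normr_Rintegral mO dVdu; rewrite ler_norml => /andP[h3 _].
  apply: (@le_trans _ _ (- (\int[mu]_(x in Omega) (dV x * du2 x)))); last first.
    by rewrite lerNl; exact: h3.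
  rewrite -subr_ge0.
  have -> : - (\int[mu]_(x in Omega) (dV x * du2 x)) -
      \int[mu]_(x in Omega) (da x * du2 x) =
      \int[mu]_(x in Omega) (((q' x - lambda') - (q x - lambda)) * u x ^+ 2) +
      \int[mu]_(x in Omega) (((q x - lambda) - (q' x - lambda')) * u' x ^+ 2).
    rewrite -[RHS]RintegralD//; first last.
    - by apply: mul_in_L1 => //; exact: (inLpB p1 Qp Qp').
    - by apply: mul_in_L1 => //; exact: (inLpB p1 Qp' Qp).
    transitivity (- 1 * \int[mu]_(x in Omega) (dV x * du2 x + da x * du2 x)).
      by rewrite RintegralD// mulN1r opprD.
    rewrite -RintegralZl//; last exact: (RintegrableD mO dVdu dadu).
    by apply: eq_Rintegral => x _; ring.
  exact: addr_ge0.
move=> /le_trans /(_ (hoelder_nrm mO p1 p'1 pp' dVp du2p)); apply: le_trans.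
rewrite nrmK//; apply: (ae_le_Rintegral mO) => //; first exact: inLp_integrable.
apply: filterS2 (optimal_ae qu) (optimal_ae qu') => x h h' Ox.
have [_ a0 -> _] := h Ox; have [_ a0' -> _] := h' Ox.
exact: powR_norm_le_mulB.
Qed.

Lemma normp'_du2_le :
  normp' du2 `^ p' <= p * (normp da * (normp a + normp a') `^ (p - 1)).
Proof.
have aap := inLpD p1 ap ap'; have aap' := powR_in_Lp' aap.
have da1 := mul_in_L1 dap aap'.
have h : normp da * normp' (fun x => `|a x + a' x| `^ (p - 1)) <=
    normp da * (normp a + normp a') `^ (p - 1).
  apply: ler_wpM2l; first exact: nrm_ge0.
  rewrite nrm_powR_in_Lp'; apply: ge0_ler_powR; rewrite ?(ltW pB1)//.
  - by rewrite nnegrE nrm_ge0.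
  - by rewrite nnegrE addr_ge0 ?nrm_ge0.
  - exact: nrmD.
rewrite nrmK//; apply: le_trans (ler_wpM2l (ltW p_gt0) h).
apply: le_trans (ler_wpM2l (ltW p_gt0) (hoelder_nrm mO p1 p'1 pp' dap aap')).
rewrite -RintegralZl//; last exact: Rintegrable_abs.
apply: (ae_le_Rintegral mO); first exact: inLp_integrable.
  by apply: RintegrableZ => //; exact: Rintegrable_abs.
apply: filterS2 (optimal_ae qu) (optimal_ae qu') => x h1 h1' Ox.
have [_ a0 -> _] := h1 Ox; have [_ a0' -> _] := h1' Ox.
apply: le_trans (powR_conj_normB_le p_gt1 a0 a0') _.
apply: le_trans (ler_powRB_norm p_gt1 a0 a0') _.
by rewrite normrM (ger0_norm (powR_ge0 _ _)) (ger0_norm (addr_ge0 a0 a0')).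
Qed.

(** The two weak equations, each tested with [u] and with [u']. *)
Lemma W012_dist_sqr_le : W012_dist Omega u u' ^+ 2 <=
  (normp (fun x => q x - lambda) +
   normp (fun x => (q x - lambda) - (q' x - lambda'))) * normp' du2.
Proof.
have uW := optimal_W012 qu; have uW' := optimal_W012 qu'.
have dQp := inLpB p1 Qp Qp'.
have mu_ := optimal_measurable qu; have mu_' := optimal_measurable qu'.
have uup := mul_in_Lp' mu_ mu_' u2p u2p'.
have uup' := mul_in_Lp' mu_' mu_ u2p' u2p.
have u2p_ := mul_in_Lp' mu_ mu_ u2p u2p.
have u2p_' := mul_in_Lp' mu_' mu_' u2p' u2p'.
rewrite /W012_dist sqr_sqrtr; last exact: Rintegral_grad_ge0.
have [W _] := uW; have [W' _] := uW'.
rewrite (Rintegral_grad_dotB oO muO W W').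
rewrite (optimal_weak qu uW u2p) (optimal_weak qu uW' u2p').
rewrite (optimal_weak qu' uW u2p) (optimal_weak qu' uW' u2p').
have i1 := mul_in_L1 Qp u2p_; have i2 := mul_in_L1 Qp uup.
have i3 := mul_in_L1 Qp' uup'; have i4 := mul_in_L1 Qp' u2p_'.
have j1 := mul_in_L1 Qp du2p; have j2 := mul_in_L1 dQp du2p.
rewrite mulrDl.
apply: le_trans (lerD (hoelder_nrm mO p1 p'1 pp' Qp du2p)
  (hoelder_nrm mO p1 p'1 pp' dQp du2p)).
rewrite -RintegralD//; [|exact: Rintegrable_abs|exact: Rintegrable_abs].
have -> : - (\int[mu]_(x in Omega) ((q x - lambda) * (u x * u x))) -
    - (\int[mu]_(x in Omega) ((q x - lambda) * (u x * u' x))) -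
    - (\int[mu]_(x in Omega) ((q' x - lambda') * (u' x * u x))) +
    - (\int[mu]_(x in Omega) ((q' x - lambda') * (u' x * u' x))) =
    \int[mu]_(x in Omega) ((q x - lambda) * (u x * u' x)) -
    \int[mu]_(x in Omega) ((q x - lambda) * (u x * u x)) +
    (\int[mu]_(x in Omega) ((q' x - lambda') * (u' x * u x)) -
    \int[mu]_(x in Omega) ((q' x - lambda') * (u' x * u' x))) by ring.
rewrite -RintegralB// -RintegralB// -RintegralD//;
  [|exact: RintegrableB|exact: RintegrableB].
apply: (ae_le_Rintegral mO).
- by apply: RintegrableD => //; exact: RintegrableB.
- by apply: RintegrableD => //; exact: Rintegrable_abs.
apply: filterS2 (optimal_ae qu) (optimal_ae qu') => x h h' Ox.
have [/ltW u0 _ _ _] := h Ox; have [/ltW u0' _ _ _] := h' Ox.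
set Q := q x - lambda; set Q' := q' x - lambda'.
have -> : Q * (u x * u' x) - Q * (u x * u x) +
    (Q' * (u' x * u x) - Q' * (u' x * u' x)) =
    - (Q * (u x - u' x) ^+ 2) - (Q - Q') * (u' x * (u x - u' x)) by ring.
apply: lerD.
  apply: le_trans (ler_norm _) _; rewrite normrN normrM [leRHS]normrM.
  apply: ler_wpM2l => //.
  by rewrite ger0_norm ?sqr_ge0//; exact: sqrB_le_norm_sqrB.
apply: le_trans (ler_norm _) _; rewrite normrN normrM [leRHS]normrM.
apply: ler_wpM2l => //.
exact: mulB_le_norm_sqrB.
Qed.

Lemma optimal_pair_bounds (M : R) : normp (fun x => q0 x - lambda) <= M ->
  normp (fun x => q0' x - lambda') <= M ->
  [/\ normp da `^ p <= 2 * M `^ (p - 1) * normp dV,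
      normp' du2 `^ p' <= p * (2 * M) `^ (p - 1) * normp da &
      W012_dist Omega u u' ^+ 2 <= 6 * M * normp' du2].
Proof.
move=> VM VM'.
have aM := le_trans (normp_excess_le qu) VM.
have aM' := le_trans (normp_excess_le qu') VM'.
have a0 := nrm_ge0 mu Omega p a; have a0' := nrm_ge0 mu Omega p a'.
have M0 : 0 <= M := le_trans a0 aM.
have mono s t : 0 <= s -> s <= t -> s `^ (p - 1) <= t `^ (p - 1).
  move=> s0 st; apply: ge0_ler_powR; rewrite ?(ltW pB1)//.
  by rewrite nnegrE (le_trans s0).
have twoE (x : R) : 2 * x = x + x by rewrite mulr_natl mulr2n.
have daM : normp da <= M + M := le_trans (nrmB mO p1 ap ap') (lerD aM aM').
have dVM : normp dV <= M + M := le_trans (nrmB mO p1 Vp Vp') (lerD VM VM').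
split.
- apply: le_trans normp_da_le _; rewrite mulrC; apply: ler_wpM2r; first exact: nrm_ge0.
  have uM : normp' (fun x => u x ^+ 2) <= M `^ (p - 1).
    by rewrite (nrm_optimal_sqr qu); exact: mono.
  have uM' : normp' (fun x => u' x ^+ 2) <= M `^ (p - 1).
    by rewrite (nrm_optimal_sqr qu'); exact: mono.
  rewrite twoE; exact: le_trans (nrmB mO p'1 u2p u2p') (lerD uM uM').
- apply: le_trans normp'_du2_le _; rewrite -mulrA; apply: ler_wpM2l; first exact: ltW.
  rewrite mulrC; apply: ler_wpM2r; first exact: nrm_ge0.
  by apply: mono; [exact: addr_ge0|rewrite twoE; exact: lerD].
- apply: le_trans W012_dist_sqr_le _; apply: ler_wpM2r; first exact: nrm_ge0.
  have QM : normp (fun x => q x - lambda) <= M + M.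
    rewrite (@eq_nrm _ _ _ _ _ _ _ (fun x => (q0 x - lambda) + (q x - q0 x))).
      exact: le_trans (nrmD mO p1 Vp ap) (lerD VM aM).
    by move=> x _; congr `|_|; ring.
  have dQM : normp (fun x => (q x - lambda) - (q' x - lambda')) <= (M + M) + (M + M).
    rewrite (@eq_nrm _ _ _ _ _ _ _ (fun x => dV x + da x)).
      exact: le_trans (nrmD mO p1 dVp dap) (lerD dVM daM).
    by move=> x _; congr `|_|; ring.
  have -> : 6 * M = (M + M) + ((M + M) + (M + M)) by ring.
  exact: lerD.
Qed.

End two_pairs.

(** If a power of [y] is at most a multiple of [t], then [y] is small with [t]. *)
Lemma small_of_powR (c s e : R) : 0 <= c -> 0 < s -> 0 < e ->
  exists2 d : R, 0 < d &
    forall t y : R, 0 <= t -> t < d -> 0 <= y -> y `^ s <= c * t -> y < e.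
Proof.
move=> c0 s0 e0; have c10 : 0 < c + 1 by rewrite ltr_wpDl.
exists (e `^ s / (c + 1)); first by rewrite divr_gt0// powR_gt0.
move=> t y t0; rewrite ltr_pdivlMr// => td y0 yt; rewrite ltNge; apply/negP => ey.
have : e `^ s <= y `^ s.
  by apply: ge0_ler_powR => //; rewrite ?(ltW s0) ?nnegrE ?(ltW e0).
by lra.
Qed.

(** Continuous dependence of the optimal pair on the shifted potential
    [q0 - lambda]. *)
Lemma optimal_pair_continuous lambda q0 q u (e : R) :
  optimal_pair lambda q0 q u -> 0 < e -> exists2 d : R, 0 < d &
    forall lambda' q0' q' u', optimal_pair lambda' q0' q' u' ->
      normp (fun x => (q0 x - lambda) - (q0' x - lambda')) < d ->
      W012_dist Omega u u' < e /\
      normp (fun x => (q x - q0 x) - (q' x - q0' x)) < e.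
Proof.
move=> qu e0.
(* M bounds the norms of both shifted potentials once their distance is at
   most 1; d1, d2 and d3 control in turn the W^{1,2}_0 distance, the difference
   of the squares and the difference of the excesses *)
pose M := normp (fun x => q0 x - lambda) + 1.
have M0 : 0 <= M by rewrite addr_ge0 ?nrm_ge0.
have [d1 d10 d1P] : exists2 d : R, 0 < d & forall t y : R, 0 <= t -> t < d ->
    0 <= y -> y `^ 2 <= 6 * M * t -> y < e.
  by apply: small_of_powR => //; rewrite ?mulr_ge0.
have [d2 d20 d2P] : exists2 d : R, 0 < d & forall t y : R, 0 <= t -> t < d ->
    0 <= y -> y `^ p' <= p * (2 * M) `^ (p - 1) * t -> y < d1.
  apply: small_of_powR => //; first by rewrite mulr_ge0 ?powR_ge0// ltW.
  by rewrite (lt_le_trans _ p'1).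
have [d3 d30 d3P] : exists2 d : R, 0 < d & forall t y : R, 0 <= t -> t < d ->
    0 <= y -> y `^ p <= 2 * M `^ (p - 1) * t -> y < Num.min d2 e.
  apply: small_of_powR => //; first by rewrite mulr_ge0 ?powR_ge0.
  by rewrite lt_min d20.
exists (Num.min 1 d3); first by rewrite lt_min ltr01.
move=> lambda' q0' q' u' qu'; rewrite lt_min => /andP[dV1 dV3].
have VM : normp (fun x => q0 x - lambda) <= M by rewrite /M lerDl.
have VM' : normp (fun x => q0' x - lambda') <= M.
  have Vp : inLp mu Omega p (fun x => q0 x - lambda).
    by apply: shift_in_Lp; exact: optimal_in_Lp0 qu.
  have Vp' : inLp mu Omega p (fun x => q0' x - lambda').
    by apply: shift_in_Lp; exact: optimal_in_Lp0 qu'.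
  apply: le_trans (nrm_le_addB mO p1 Vp Vp') _.
  by rewrite /M lerD2l ltW.
have [h3 h2 h1] := optimal_pair_bounds qu qu' VM VM'.
have := d3P _ _ (nrm_ge0 _ _ _ _) dV3 (nrm_ge0 _ _ _ _) h3.
rewrite lt_min => /andP[da2 dae]; split => //.
have du1 := d2P _ _ (nrm_ge0 _ _ _ _) da2 (nrm_ge0 _ _ _ _) h2.
apply: (d1P _ _ (nrm_ge0 _ _ _ _) du1 (sqrtr_ge0 _)).
by rewrite powR_mulrn ?sqrtr_ge0.
Qed.

End stability.

Theorem proposition1 (R : realType) (N : nat) (Omega : set 'rV[R]_N) (p : R)
    (qhat uhat : R -> ('rV[R]_N -> R) -> 'rV[R]_N -> R)
    (N_gt0 : (0 < N)%N)
    (Omega_domain : bounded_C11_domain Omega)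
    (p_adm : admissible_exponent N p)
    (qhatP : forall (lambda : R) (q0 : 'rV[R]_N -> R),
      in_Lp Omega p q0 -> lambda1 Omega q0 < lambda ->
      is_qhat Omega p lambda q0 (qhat lambda q0))
    (uhatP : forall (lambda : R) (q0 : 'rV[R]_N -> R),
      in_Lp Omega p q0 -> lambda1 Omega q0 < lambda ->
      is_uhat Omega p lambda q0 (qhat lambda q0) (uhat lambda q0)) :
  (forall lambda : R,
    let D := [set q0 | in_Lp Omega p q0 /\ lambda1 Omega q0 < lambda] in
    dist_continuous_on (Lp_dist Omega p) (W012_dist Omega) D (uhat lambda) /\
    dist_continuous_on (Lp_dist Omega p) (Lp_dist Omega p) D (qhat lambda)) /\
  (forall q0 : 'rV[R]_N -> R, in_Lp Omega p q0 ->
    let D := [set lambda | lambda1 Omega q0 < lambda] in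
    let dR := fun a b : R => `|a - b| in
    [/\ dist_continuous_on dR (W012_dist Omega) D (uhat ^~ q0),
        dist_continuous_on dR (Lp_dist Omega p) D (qhat ^~ q0) &
        Lp_dist Omega p (qhat lambda q0) q0
          @[lambda --> (lambda1 Omega q0)^'+] --> (0 : R)]).
Proof.
have [_ oO _ bO _] := Omega_domain.
have muO := lebesgue_bounded_lty (measurable_open_rV oO) bO.
have p2 : 2 <= p by exact: admissible_exponent_ge2 p_adm.
have p1 : 1 <= p by apply: le_trans p2; rewrite ler1n.
have p0 : p != 0 by rewrite gt_eqF// (lt_le_trans ltr01).
have rayleighP q : in_Lp Omega p q -> has_lbound (rayleigh_set Omega q).
  apply: rayleigh_has_lbound => // lambda q0 q0p ll.
  by exists (qhat lambda q0); exact: qhatP.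
have pairP lambda q0 : in_Lp Omega p q0 -> lambda1 Omega q0 < lambda ->
    optimal_pair Omega p lambda q0 (qhat lambda q0) (uhat lambda q0).
  by move=> q0p ll; split => //; [exact: qhatP|exact: uhatP].
have cont lambda q0 q u :=
  @optimal_pair_continuous _ _ _ _ oO muO p2 rayleighP lambda q0 q u.
split.
  move=> lambda /=; split => q0 [q0p ll] e e0.
    have [d d0 dP] := cont _ _ _ _ _ (pairP _ _ q0p ll) e0.
    exists d => // q1 [q1p ll1]; rewrite Lp_distE// => q01.
    have := dP _ _ _ _ (pairP _ _ q1p ll1).
    rewrite (@eq_nrm _ _ _ _ _ _ _ (fun x => q0 x - q1 x)); last first.
      by move=> x _; congr `|_|; ring.
    by move=> /(_ q01)[].
  have e20 : 0 < e / 2 by rewrite divr_gt0.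
  have [d d0 dP] := cont _ _ _ _ _ (pairP _ _ q0p ll) e20.
  exists (Num.min d (e / 2)); first by rewrite lt_min d0.
  move=> q1 [q1p ll1]; rewrite !Lp_distE// lt_min => /andP[q01d q01e].
  have := dP _ _ _ _ (pairP _ _ q1p ll1).
  rewrite (@eq_nrm _ _ _ _ _ _ _ (fun x => q0 x - q1 x)); last first.
    by move=> x _; congr `|_|; ring.
  move=> /(_ q01d)[_ da].
  have ap := optimal_excess_in_Lp p2 (pairP _ _ q0p ll).
  have ap' := optimal_excess_in_Lp p2 (pairP _ _ q1p ll1).
  rewrite (@eq_nrm _ _ _ _ _ _ _ (fun x => (q0 x - q1 x) +
    ((qhat lambda q0 x - q0 x) - (qhat lambda q1 x - q1 x)))); last first.
    by move=> x _; congr `|_|; ring.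
  apply: le_lt_trans (nrmD (measurable_open_rV oO) p1 (inLpB p1 q0p q1p)
    (inLpB p1 ap ap')) _.
  by rewrite [e]splitr ltrD.
move=> q0 q0p /=.
(* for a fixed q0, the shifted potentials differ by a constant *)
have cont1 lambda e : lambda1 Omega q0 < lambda -> 0 < e ->
    exists2 d : R, 0 < d & forall lambda', lambda1 Omega q0 < lambda' ->
      `|lambda - lambda'| < d ->
      W012_dist Omega (uhat lambda q0) (uhat lambda' q0) < e /\
      Lp_dist Omega p (qhat lambda q0) (qhat lambda' q0) < e.
  move=> ll e0; have [d d0 dP] := cont _ _ _ _ _ (pairP _ _ q0p ll) e0.
  have n10 := nrm_ge0 (@lebesgue_rV R N) Omega p (cst 1).
  have n11 : 0 < nrm (@lebesgue_rV R N) Omega p (cst 1) + 1 by rewrite ltr_wpDl.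
  exists (d / (nrm (@lebesgue_rV R N) Omega p (cst 1) + 1)).
    by rewrite divr_gt0.
  move=> lambda' ll' h; have := dP _ _ _ _ (pairP _ _ q0p ll').
  have -> : nrm (@lebesgue_rV R N) Omega p
      (fun x => q0 x - lambda - (q0 x - lambda')) =
      `|lambda - lambda'| * nrm (@lebesgue_rV R N) Omega p (cst 1).
    rewrite -(nrm_cst (@lebesgue_rV R N) (measurable_open_rV oO) _ p0).
    by apply: eq_nrm => x _ /=; rewrite -normrN; congr `|_|; ring.
  rewrite Lp_distE//.
  rewrite (@eq_nrm _ _ _ _ _ _
    (fun x => qhat lambda q0 x - q0 x - (qhat lambda' q0 x - q0 x))
    (fun x => qhat lambda q0 x - qhat lambda' q0 x)); last first.
    by move=> x _; congr `|_|; ring.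
  apply.
  move: h; rewrite ltr_pdivlMr//; apply: le_lt_trans.
  by apply: ler_wpM2l => //; rewrite lerDl.
split.
- move=> lambda ll e e0; have [d d0 dP] := cont1 _ _ ll e0.
  by exists d => // lambda' ll' h; have [] := dP _ ll' h.
- move=> lambda ll e e0; have [d d0 dP] := cont1 _ _ ll e0.
  by exists d => // lambda' ll' h; have [] := dP _ ll' h.
- apply/cvgr0Pnorm_lt => e e0.
  have n10 := nrm_ge0 (@lebesgue_rV R N) Omega p (cst 1).
  have n11 : 0 < nrm (@lebesgue_rV R N) Omega p (cst 1) + 1 by rewrite ltr_wpDl.
  near=> lambda.
  have ll : lambda1 Omega q0 < lambda by near: lambda; exact: nbhs_right_gt.
  have lle : lambda < lambda1 Omega q0 +
      e / (nrm (@lebesgue_rV R N) Omega p (cst 1) + 1).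
    by near: lambda; apply: nbhs_right_lt; rewrite ltrDl divr_gt0.
  rewrite Lp_distE// ger0_norm ?nrm_ge0//.
  have := normp_excess_le_lambda1 oO muO p2 rayleighP (pairP _ _ q0p ll) (ltW ll).
  move=> /le_lt_trans; apply.
  move: lle; rewrite -ltrBlDl ltr_pdivlMr//; apply: le_lt_trans.
  by apply: ler_wpM2l; rewrite ?subr_ge0 ?(ltW ll)// lerDl.
Unshelve. all: by end_near. Qed.
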